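(* Let $U$ be an open set in $\mathbb{C}^n$ and let $\pi:\tilde U\rightarrow U$ be the blow-up of $U$ along a coherent sheaf of ideals $\mathcal{I}$ which is generated by global sections $f_1,\dots,f_r$ on $U$. Suppose that the blow-up is non-trivial and that $\tilde U$ is smooth. Let $E$ be the exceptional divisor and $L_E$ the associated line bundle on $\tilde U$. Then the embedding $\iota_f:\tilde U\hookrightarrow U\times\mathbb{P}^{r-1}$ induces a metric $h$ on $L_E$ whose Chern form $c_1(L_E,h)$ is negative semi-definite on $\tilde U$, negative definite on the fibres of the map $E\rightarrow C=V(\mathcal{I})$, and given on $\tilde U-E$ by $$c_1(L_E,h)=\pi^*\Bigl(-\frac{\sqrt{-1}}{2\pi}\,\partial\overline\partial\log\sum_{j=1}^r|f_j(z)|^2\Bigr).$$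
   Context: $V(\mathcal{I})$ is the closed complex subspace determined by $\mathcal{I}$. The blow-up $\tilde U$ is the smallest reduced complex analytic subspace of $U\times\mathbb{P}^{r-1}$ containing the graph $\{(z,[f_1(z):\dots:f_r(z)]):z\in U\setminus V(\mathcal{I})\}$; $\iota_f$ is the inclusion and $\pi$ is the projection to $U$. ''Non-trivial'' means that $V(\mathcal{I})$ has codimension at least 1 in $U$ and $\mathcal{I}$ is not principal on $U$ (not generated by a single function), so $r>1$. The exceptional divisor $E$ is the hypersurface defined by the inverse image ideal $\pi^{-1}\mathcal{I}\subset\mathcal{O}_{\tilde U}$ generated by the pullbacks of the $f_j$; $L_E=[E]$ is its line bundle, which is the restriction to $\tilde U$ of the pullback of the universal (tautological) bundle $\mathcal{O}_{\mathbb{P}^{r-1}}(-1)$ under the projection $\sigma_2:U\times\mathbb{P}^{r-1}\to\mathbb{P}^{r-1}$. The metric induced on $L_E$ by $\iota_f$ is the pullback of the metric on $\mathcal{O}_{\mathbb{P}^{r-1}}(-1)$ whose Chern form is the negative of the Fubini–Study form, $-\omega_{\text{Fub-St}}$, where $\omega_{\text{Fub-St}}=\frac{\sqrt{-1}}{2\pi}\partial\overline\partial\log\bigl(1+\sum_{j\ne i}|\xi_j/\xi_i|^2\bigr)$ on $\{\xi_i\ne0\}$. A hermitian metric $h$ on a line bundle $L$ is given on trivializing open sets $V_i$ by positive $C^\infty$ functions $h_i$ with $\|s\|^2=|s_i|^2h_i$; its Chern form is $c_1(L,h)=-\frac{\sqrt{-1}}{2\pi}\partial\overline\partial\log h_i$.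 *)

(* Defs.v *)
From HB Require Import structures.
From mathcomp Require Import all_boot all_order all_algebra.
From mathcomp Require Import generic_quotient complex.
From mathcomp Require Import all_classical all_reals all_analysis.

Set Implicit Arguments.
Unset Strict Implicit.
Unset Printing Implicit Defensive.
Import Order.TTheory GRing.Theory Num.Theory.
Import numFieldNormedType.Exports.
Local Open Scope classical_set_scope.
Local Open Scope ring_scope.
Local Open Scope complex_scope.

(* R[i] gets the topology and norm that the library puts on every
   numFieldType. *)
HB.instance Definition _ (R : realType) :=
  PseudoPointedMetric.copy R[i] R[i]^o.
HB.instance Definition _ (R : realType) :=
  NormedModule.copy R[i] R[i]^o.

(** * Differential calculus on open subsets of C^m *)

Definition sqnorm (R : realType) (c : R[i]) : R := complex.Re c ^+ 2 + complex.Im c ^+ 2.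

(* The derivative at a, with respect to the real variable x, of
   x |-> g (a + x v). *)
Definition rderivable (R : realType) (m : nat) (g : 'rV[R[i]]_m -> R[i])
    (v a : 'rV[R[i]]_m) : Prop :=
  derivable (fun x : R => complex.Re (g (a + x%:C *: v))) 0 1 /\
  derivable (fun x : R => complex.Im (g (a + x%:C *: v))) 0 1.

Definition rderive (R : realType) (m : nat) (g : 'rV[R[i]]_m -> R[i])
    (v a : 'rV[R[i]]_m) : R[i] :=
  Complex (derive1 (fun x : R => complex.Re (g (a + x%:C *: v))) 0)
          (derive1 (fun x : R => complex.Im (g (a + x%:C *: v))) 0).

Fixpoint Ck (R : realType) (m k : nat) (W : set 'rV[R[i]]_m)
    (g : 'rV[R[i]]_m -> R[i]) : Prop :=
  (forall a, W a -> {for a, continuous g}) /\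
  if k is k'.+1 then
    forall v, (forall a, W a -> rderivable g v a) /\ Ck k' W (rderive g v)
  else True.

Definition smooth (R : realType) (m : nat) (W : set 'rV[R[i]]_m)
    (g : 'rV[R[i]]_m -> R[i]) : Prop := forall k, Ck k W g.

(* The Wirtinger derivatives d/dz_j and d/dzbar_j. *)
Definition dz (R : realType) (m : nat) (j : 'I_m) (g : 'rV[R[i]]_m -> R[i])
    (a : 'rV[R[i]]_m) : R[i] :=
  (rderive g (delta_mx 0 j) a - 'i%C * rderive g ('i%C *: delta_mx 0 j) a) / 2.

Definition dzbar (R : realType) (m : nat) (j : 'I_m) (g : 'rV[R[i]]_m -> R[i])
    (a : 'rV[R[i]]_m) : R[i] :=
  (rderive g (delta_mx 0 j) a + 'i%C * rderive g ('i%C *: delta_mx 0 j) a) / 2.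

(* C^oo functions satisfying the Cauchy-Riemann equations. *)
Definition holo (R : realType) (m : nat) (W : set 'rV[R[i]]_m)
    (g : 'rV[R[i]]_m -> R[i]) : Prop :=
  smooth W g /\ forall a, W a -> forall j, dzbar j g a = 0.

Definition holo_map (R : realType) (m p : nat) (W : set 'rV[R[i]]_m)
    (F : 'rV[R[i]]_m -> 'rV[R[i]]_p) : Prop :=
  forall k, holo W (fun a => F a 0 k).

(* The transpose of the complex Jacobian matrix of F at a. *)
Definition jacobian (R : realType) (m p : nat)
    (F : 'rV[R[i]]_m -> 'rV[R[i]]_p) (a : 'rV[R[i]]_m) : 'M[R[i]]_(m, p) :=
  \matrix_(j, k) dz j (fun b => F b 0 k) a.

(** * (1,1)-forms

   The form \sum_(j, k) a_jk dz_j /\ dzbar_k at a point of C^m is represented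
   by the matrix (a_jk). *)

Definition adjmx (R : realType) (m p : nat) (A : 'M[R[i]]_(m, p)) :
  'M[R[i]]_(p, m) := (map_mx Num.conj A)^T.

Definition ddbar (R : realType) (m : nat) (u : 'rV[R[i]]_m -> R)
    (a : 'rV[R[i]]_m) : 'M[R[i]]_m :=
  \matrix_(j, k) dz j (dzbar k (fun b => (u b)%:C)) a.

(* - (sqrt(-1) / 2 pi) ddbar u *)
Definition curvature (R : realType) (m : nat) (u : 'rV[R[i]]_m -> R)
    (a : 'rV[R[i]]_m) : 'M[R[i]]_m :=
  (- ('i%C / (2 * pi)%:C)) *: ddbar u a.

(* dF_k = \sum_j (jacobian F a) j k dz_j *)
Definition pullback_form (R : realType) (m p : nat)
    (F : 'rV[R[i]]_m -> 'rV[R[i]]_p) (w : 'rV[R[i]]_p -> 'M[R[i]]_p)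
    (a : 'rV[R[i]]_m) : 'M[R[i]]_m :=
  jacobian F a *m w (F a) *m adjmx (jacobian F a).

(* The (1,1)-form (a_jk) is sqrt(-1) \sum_(j, k) H_jk dz_j /\ dzbar_k with
   H = - sqrt(-1) (a_jk); it is negative (semi-)definite when the hermitian
   form v |-> \sum_(j, k) H_jk v_j conj(v_k) is.  For the order of R[i], x <= 0
   and x < 0 include that x is real. *)
Definition herm_of_form (R : realType) (m : nat) (w : 'M[R[i]]_m)
    (v : 'rV[R[i]]_m) : R[i] :=
  (v *m ((- 'i%C) *: w) *m adjmx v) 0 0.

(** * Complex manifolds, analytic subsets *)

(* A complex manifold with underlying type T is given by its local coordinate
   systems phi : D -> T, where D is open in C^d.  For sub_atlas and
   blowup_atlas below, any two of them are holomorphically compatible. *)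
Definition atlas (R : realType) (T : Type) : Type :=
  forall d : nat, set 'rV[R[i]]_d -> ('rV[R[i]]_d -> T) -> Prop.

Definition carrier (R : realType) (T : Type) (M : atlas R T) : set T :=
  [set p | exists d (D : set 'rV[R[i]]_d) phi, M d D phi /\ (phi @` D) p].

Definition mopen (R : realType) (T : Type) (M : atlas R T) (V : set T) : Prop :=
  V `<=` carrier M /\
  forall d (D : set 'rV[R[i]]_d) phi, M d D phi -> open (D `&` phi @^-1` V).

Definition msmooth (R : realType) (T : Type) (M : atlas R T) (V : set T)
    (s : T -> R[i]) : Prop :=
  forall d (D : set 'rV[R[i]]_d) phi, M d D phi ->
    smooth (D `&` phi @^-1` V) (s \o phi).

Definition mholo (R : realType) (T : Type) (M : atlas R T) (V : set T)
    (s : T -> R[i]) : Prop :=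
  forall d (D : set 'rV[R[i]]_d) phi, M d D phi ->
    holo (D `&` phi @^-1` V) (s \o phi).

(* The local coordinate systems of a subset A of C^N: the biholomorphic maps
   from an open subset D of C^d onto an open part of A, the inverse q being
   locally the restriction of a holomorphic map on an open subset of C^N. *)
Definition sub_atlas (R : realType) (N : nat) (A : set 'rV[R[i]]_N) :
    atlas R 'rV[R[i]]_N :=
  fun d D phi =>
    [/\ open D, holo_map D phi,
        exists2 O, open O & phi @` D = A `&` O
      & forall t, D t -> exists W (q : 'rV[R[i]]_N -> 'rV[R[i]]_d),
          [/\ open W, W (phi t), holo_map W q
            & forall s, D s -> W (phi s) -> q (phi s) = s]].

(* The codimension of an analytic subset A of C^n is at least 1: the manifold
   points of A have dimension at most n - 1. *)
Definition codim_ge1 (R : realType) (n : nat) (A : set 'rV[R[i]]_n) : Prop :=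
  forall d (D : set 'rV[R[i]]_d) phi,
    sub_atlas A D phi -> D !=set0 -> (d < n)%N.

(* A is a closed complex analytic subset of the open set O. *)
Definition analytic_in (R : realType) (N : nat) (O A : set 'rV[R[i]]_N) :
    Prop :=
  A `<=` O /\
  forall x, O x -> exists (W : set 'rV[R[i]]_N) m (g : 'I_m -> 'rV[R[i]]_N -> R[i]),
    [/\ open W, W x, W `<=` O, forall k, holo W (g k)
      & forall y, W y -> (A y <-> forall k, g k y = 0)].

(* The ideal sheaves generated on V by F_1, ..., F_a and by G_1, ..., G_b
   coincide. *)
Definition in_ideal (R : realType) (T : Type) (M : atlas R T) (a : nat)
    (F : 'I_a -> T -> R[i]) (W : set T) (g : T -> R[i]) : Prop :=
  exists2 c : 'I_a -> T -> R[i], forall k, mholo M W (c k)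
    & forall p, W p -> g p = \sum_k c k p * F k p.

Definition same_ideal (R : realType) (T : Type) (M : atlas R T) (V : set T)
    (a b : nat) (F : 'I_a -> T -> R[i]) (G : 'I_b -> T -> R[i]) : Prop :=
  forall p, V p -> exists W,
    [/\ mopen M W, W p, W `<=` V, forall j, in_ideal M F W (G j)
      & forall k, in_ideal M G W (F k)].

(** * Line bundles *)

(* A line bundle is given by trivializing open sets V_i and transition
   functions g_ij on V_i `&` V_j; the local expressions of a section s satisfy
   s_i = g_ij s_j. *)
Record line_bundle (R : realType) (T : Type) := LineBundle {
  lb_index : Type;
  lb_dom : lb_index -> set T;
  lb_trans : lb_index -> lb_index -> T -> R[i]
}.
Arguments lb_index {R T} l.
Arguments lb_dom {R T} l _ _.
Arguments lb_trans {R T} l _ _ _.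

Definition is_line_bundle (R : realType) (T : Type) (M : atlas R T)
    (L : line_bundle R T) : Prop :=
  [/\ forall i, mopen M (lb_dom L i),
      forall p, carrier M p -> exists i, lb_dom L i p,
      forall i j, mholo M (lb_dom L i `&` lb_dom L j) (lb_trans L i j),
      forall i j p, lb_dom L i p -> lb_dom L j p -> lb_trans L i j p != 0
    & forall i j k p, lb_dom L i p -> lb_dom L j p -> lb_dom L k p ->
        lb_trans L i k p = lb_trans L i j p * lb_trans L j k p].

(* The functions s_i are local equations, on the sets V_i of the line bundle
   L, of the divisor with ideal sheaf generated by F_1, ..., F_a (the s_i are
   not zero divisors), and L = [E] for this divisor E: g_ij = s_i / s_j. *)
Definition is_divisor_bundle (R : realType) (T : Type) (M : atlas R T)
    (a : nat) (F : 'I_a -> T -> R[i]) (L : line_bundle R T)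
    (s : lb_index L -> T -> R[i]) : Prop :=
  [/\ is_line_bundle M L,
      forall i, mholo M (lb_dom L i) (s i),
      forall i, same_ideal M (lb_dom L i) F (fun _ : 'I_1 => s i),
      forall i W, mopen M W -> W `<=` lb_dom L i -> W !=set0 ->
        exists2 p, W p & s i p != 0
    & forall i j p, lb_dom L i p -> lb_dom L j p ->
        s i p = lb_trans L i j p * s j p].

Arguments is_divisor_bundle {R T} M {a} F L s.

(* ||s||^2 = |s_i|^2 h_i on V_i *)
Definition is_hermitian_metric (R : realType) (T : Type) (M : atlas R T)
    (L : line_bundle R T) (h : lb_index L -> T -> R) : Prop :=
  [/\ forall i, msmooth M (lb_dom L i) (fun p => (h i p)%:C),
      forall i p, lb_dom L i p -> 0 < h i p
    & forall i j p, lb_dom L i p -> lb_dom L j p ->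
        h j p = sqnorm (lb_trans L i j p) * h i p].

Arguments is_hermitian_metric {R T} M L h.

(* The expression, in the coordinate system phi, of the Chern form on V_i of
   the metric with weights h_i. *)
Definition chern_form (R : realType) (T : Type) (hi : T -> R) (d : nat)
    (phi : 'rV[R[i]]_d -> T) : 'rV[R[i]]_d -> 'M[R[i]]_d :=
  curvature (fun t => ln (hi (phi t))).

Definition pullback_bundle (R : realType) (S T : Type) (Y : set S) (F : S -> T)
    (L : line_bundle R T) : line_bundle R S :=
  LineBundle (fun i => Y `&` F @^-1` lb_dom L i)
             (fun i j p => lb_trans L i j (F p)).

(** * Projective space *)

Definition nz_row (R : realType) (r : nat) := {v : 'rV[R[i]]_r | v != 0}.

Definition proportional (R : realType) (r : nat) (v w : nz_row R r) : bool :=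
  `[< exists c : R[i], val v = c *: val w >].

Lemma proportional_refl (R : realType) (r : nat) :
  reflexive (@proportional R r).
Proof. by move=> v; apply/asboolP; exists 1; rewrite scale1r. Qed.

Lemma proportional_sym (R : realType) (r : nat) :
  symmetric (@proportional R r).
Proof.
move=> v w; suff H a b : proportional a b -> @proportional R r b a.
  by apply/idP/idP; apply: H.
move=> /asboolP[c e]; apply/asboolP; exists c^-1.
have c0 : c != 0.
  by apply: contraTneq (valP a) => c0; rewrite e c0 scale0r eqxx.
by rewrite e scalerA mulVf// scale1r.
Qed.

Lemma proportional_trans (R : realType) (r : nat) :
  transitive (@proportional R r).
Proof.
move=> w v u /asboolP[c e] /asboolP[c' e']; apply/asboolP; exists (c * c').
by rewrite e e' scalerA.
Qed.

Definition proportional_rel (R : realType) (r : nat) :=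
  EquivRel (@proportional R r) (@proportional_refl R r)
    (@proportional_sym R r) (@proportional_trans R r).

(* P^(r-1), the quotient of C^r \ {0} by proportionality. *)
Definition proj_space (R : realType) (r : nat) :=
  {eq_quot proportional_rel R r}%qT.

Definition proj_point (R : realType) (r : nat) (v : 'rV[R[i]]_r)
    (v_neq0 : v != 0) : proj_space R r :=
  (\pi_(proj_space R r) (exist _ v v_neq0 : nz_row R r))%qT.

(* A vector xi of homogeneous coordinates of the point. *)
Definition hcoord (R : realType) (r : nat) (p : proj_space R r) :
  'rV[R[i]]_r := val (repr p).

Definition affine_row (R : realType) (r : nat) (i : 'I_r)
    (w : 'rV[R[i]]_r.-1) : 'rV[R[i]]_r :=
  \row_j (if unlift i j is Some k then w 0 k else 1).

Lemma affine_row_neq0 (R : realType) (r : nat) (i : 'I_r) w :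
  @affine_row R r i w != 0.
Proof.
apply/eqP => /rowP/(_ i); rewrite !mxE unlift_none => /eqP.
by rewrite oner_eq0.
Qed.

(* The chart {xi_i != 0} of C^n x P^(r-1): the last r - 1 coordinates are the
   xi_j / xi_i, j != i. *)
Definition chart (R : realType) (n r : nat) (i : 'I_r)
    (x : 'rV[R[i]]_(n + r.-1)) : 'rV[R[i]]_n * proj_space R r :=
  (lsubmx x, proj_point (affine_row_neq0 i (rsubmx x))).

(* A is a closed complex analytic subset of U x P^(r-1). *)
Definition analytic_subset (R : realType) (n r : nat) (U : set 'rV[R[i]]_n)
    (A : set ('rV[R[i]]_n * proj_space R r)) : Prop :=
  A `<=` [set p | U p.1] /\
  forall i : 'I_r, analytic_in (chart i @^-1` [set p | U p.1]) (chart i @^-1` A).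

(* O(-1): a point of the fibre over [xi] is a vector v in C xi, its coordinate
   over {xi_i != 0} is v_i, and v_i = (xi_i / xi_j) v_j. *)
Definition taut_bundle (R : realType) (r : nat) :
    line_bundle R (proj_space R r) :=
  LineBundle (fun i : 'I_r => [set p | hcoord p 0 i != 0])
             (fun i j p => hcoord p 0 i / hcoord p 0 j).

(* The restriction of the norm of C^r: |v|^2 = |v_i|^2 h_i for v in C xi. *)
Definition taut_metric (R : realType) (r : nat) (i : 'I_r)
    (p : proj_space R r) : R :=
  1 + \sum_(j | j != i) sqnorm (hcoord p 0 j / hcoord p 0 i).

(** * The blow-up *)

Definition zero_locus (R : realType) (n r : nat) (U : set 'rV[R[i]]_n)
    (f : 'I_r -> 'rV[R[i]]_n -> R[i]) : set 'rV[R[i]]_n :=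
  [set z | U z /\ forall j, f j z = 0].

Definition principal_ideal (R : realType) (n r : nat) (U : set 'rV[R[i]]_n)
    (f : 'I_r -> 'rV[R[i]]_n -> R[i]) : Prop :=
  exists2 g : 'rV[R[i]]_n -> R[i], holo U g
    & same_ideal (sub_atlas U) U f (fun _ : 'I_1 => g).

Definition graph (R : realType) (n r : nat) (U : set 'rV[R[i]]_n)
    (f : 'I_r -> 'rV[R[i]]_n -> R[i]) : set ('rV[R[i]]_n * proj_space R r) :=
  [set p | (U `\` zero_locus U f) p.1 /\
     exists nz : \row_j f j p.1 != 0, p.2 = proj_point nz].

(* The intersection of all closed analytic subsets of U x P^(r-1) containing
   the graph. *)
Definition blowup (R : realType) (n r : nat) (U : set 'rV[R[i]]_n)
    (f : 'I_r -> 'rV[R[i]]_n -> R[i]) : set ('rV[R[i]]_n * proj_space R r) :=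
  smallest (@analytic_subset R n r U) (graph U f).

(* The coordinate systems of the blow-up, each contained in a chart of
   C^n x P^(r-1). *)
Definition blowup_atlas (R : realType) (n r : nat) (U : set 'rV[R[i]]_n)
    (f : 'I_r -> 'rV[R[i]]_n -> R[i]) :
    atlas R ('rV[R[i]]_n * proj_space R r) :=
  fun d D phi => exists i psi,
    sub_atlas (chart i @^-1` blowup U f) D psi /\ phi = chart i \o psi.

(* Each point has a neighbourhood in the blow-up which is biholomorphic to an
   open subset of some C^d. *)
Definition blowup_smooth (R : realType) (n r : nat) (U : set 'rV[R[i]]_n)
    (f : 'I_r -> 'rV[R[i]]_n -> R[i]) : Prop :=
  blowup U f `<=` carrier (blowup_atlas U f).

Definition exceptional (R : realType) (n r : nat) (U : set 'rV[R[i]]_n)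
    (f : 'I_r -> 'rV[R[i]]_n -> R[i]) : set ('rV[R[i]]_n * proj_space R r) :=
  [set p | blowup U f p /\ forall j, f j p.1 = 0].

(* The restriction to the blow-up of the pullback of O(-1) under the second
   projection, with the pullback of the metric of O(-1).  That it is [E] is
   expressed by is_divisor_bundle with the local equations f_i of E on
   {xi_i != 0}, for which f_i / f_j = xi_i / xi_j. *)
Definition exceptional_bundle (R : realType) (n r : nat) (U : set 'rV[R[i]]_n)
    (f : 'I_r -> 'rV[R[i]]_n -> R[i]) :
    line_bundle R ('rV[R[i]]_n * proj_space R r) :=
  pullback_bundle (blowup U f) snd (taut_bundle R r).

Definition induced_metric (R : realType) (n r : nat) (i : 'I_r)
    (p : 'rV[R[i]]_n * proj_space R r) : R := taut_metric i p.2.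

(* v, a tangent vector of the blow-up at phi t in the coordinates phi, is
   tangent to the fibre of the projection to U through that point.  The fibre
   may be singular: its Zariski tangent space, the kernel of the differential
   of the projection, is meant. *)
Definition fibre_tangent (R : realType) (n r d : nat)
    (phi : 'rV[R[i]]_d -> 'rV[R[i]]_n * proj_space R r)
    (t v : 'rV[R[i]]_d) : Prop :=
  v *m jacobian (fst \o phi) t = 0.

(* Main.v *)
Require Import Defs.
From mathcomp Require Import all_boot all_order all_algebra.
From mathcomp Require Import generic_quotient complex.
From mathcomp Require Import all_classical all_reals all_analysis.
From mathcomp Require Import ring lra.
Import Order.TTheory GRing.Theory Num.Theory.
Import numFieldNormedType.Exports.
Local Open Scope classical_set_scope.
Local Open Scope ring_scope.

(** The weight of the metric of O(-1) on {xi_i != 0} is the sum of the squared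
   moduli of the holomorphic functions w_l = xi_l / xi_i.  By Lagrange's identity
   (ddbar_ln_sum), ddbar log (|w_1|^2 + ... + |w_N|^2) is the sum of the squares
   of the 2-by-2 minors w_p dw_l - w_l dw_p, divided by 2 |w|^4.  The curvature
   statements are read off from this formula.  Minus a sum of squares is negative
   semi-definite.  On a vector v where the form vanishes all dw_l (v) vanish,
   because w_i = 1; if v is moreover killed by the differential of the projection
   to U, then v is tangent to the blow-up and killed by all coordinate
   differentials of U x P^(r-1), so v = 0 (blowup_tangent_eq0).  Off the
   exceptional set w_l = f_l / f_i, because the equations f_k xi_l = f_l xi_k
   hold on the graph and so on every point of the blow-up; the minors do not see
   the common factor 1 / f_i, and what is left is the pullback of the form of
   (f_1, ..., f_r) (chern_form_off_exceptional).

   The same equations give f_i = (xi_i / xi_j) f_j, so the f_i are local equations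
   of E with the transition functions of O(-1).  That no f_i vanishes on an open
   part of the blow-up is where the minimality of the blow-up enters.  The blow-up
   is a closed submanifold and hence analytic.  Near each of its points it agrees
   with the blow-up minus the relative interior of E, or is disjoint from it: by
   the identity theorem functions f_j that vanish on a piece of a coordinate ball
   vanish on a whole neighbourhood of its centre.  So this smaller set is analytic;
   it contains the graph, and equals the blow-up (exceptional_interior0).

   Holomorphic functions are smooth solutions of the Cauchy-Riemann equations.
   The chain rule for C^1 functions (cder_chain) and the symmetry of second
   derivatives show that they are closed under composition and under d/dz_j.  The
   identity theorem comes from the maximum principle: a function g that vanishes
   near 0 is bounded on the unit disk, through g / z^k, by a constant times |z|^k
   for every k (annulus_vanish). *)

Set Implicit Arguments.
Unset Strict Implicit.
Unset Printing Implicit Defensive.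

Local Notation Re := complex.Re.
Local Notation Im := complex.Im.

(** * The topology of the complex numbers and of spaces of row vectors *)

Lemma ReD (R : realType) (z w : R[i]) : Re (z + w) = Re z + Re w.
Proof. by case: z w => [? ?] [? ?]. Qed.

Lemma ImD (R : realType) (z w : R[i]) : Im (z + w) = Im z + Im w.
Proof. by case: z w => [? ?] [? ?]. Qed.

Lemma ReN (R : realType) (z : R[i]) : Re (- z) = - Re z.
Proof. by case: z. Qed.

Lemma ImN (R : realType) (z : R[i]) : Im (- z) = - Im z.
Proof. by case: z. Qed.

Lemma ReM (R : realType) (z w : R[i]) :
  Re (z * w) = Re z * Re w - Im z * Im w.
Proof. by case: z w => [? ?] [? ?]. Qed.

Lemma ImM (R : realType) (z w : R[i]) :
  Im (z * w) = Re z * Im w + Im z * Re w.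
Proof. by case: z w => [? ?] [? ?]. Qed.

Lemma Re_sum (R : realType) (I : Type) (s : seq I) (F : I -> R[i]) :
  Re (\sum_(i <- s) F i) = \sum_(i <- s) Re (F i).
Proof. by elim/big_rec2: _ => // i x y _ <-; rewrite ReD. Qed.

Lemma Im_sum (R : realType) (I : Type) (s : seq I) (F : I -> R[i]) :
  Im (\sum_(i <- s) F i) = \sum_(i <- s) Im (F i).
Proof. by elim/big_rec2: _ => // i x y _ <-; rewrite ImD. Qed.

Lemma Complex_inj (R : realType) (z w : R[i]) :
  Re z = Re w -> Im z = Im w -> z = w.
Proof. by case: z w => [? ?] [? ?] /= -> ->. Qed.

Lemma sqnorm_ge0 (R : realType) (z : R[i]) : 0 <= sqnorm z.
Proof. by rewrite addr_ge0 ?sqr_ge0. Qed.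

Lemma sqnorm_eq0 (R : realType) (z : R[i]) : (sqnorm z == 0) = (z == 0).
Proof.
case: z => x y; rewrite /sqnorm /= paddr_eq0 ?sqr_ge0// !sqrf_eq0.
by rewrite eq_complex.
Qed.

Lemma sqnormM (R : realType) (z w : R[i]) :
  sqnorm (z * w) = sqnorm z * sqnorm w.
Proof. by rewrite /sqnorm ReM ImM; ring. Qed.

Lemma sqnormC (R : realType) (z : R[i]) : (sqnorm z)%:C%C = z * conjc z.
Proof. by apply: Complex_inj; case: z => x y; rewrite /sqnorm /=; ring. Qed.

Lemma sqnorm1 (R : realType) : sqnorm (1 : R[i]) = 1.
Proof. by rewrite /sqnorm /= expr1n expr0n addr0. Qed.

Lemma sqnormV (R : realType) (z : R[i]) : sqnorm z^-1 = (sqnorm z)^-1.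
Proof.
have [->|z0] := eqVneq z 0.
  by rewrite invr0 (eqP (_ : sqnorm 0 == 0)) ?invr0// sqnorm_eq0.
have s0 : sqnorm z != 0 by rewrite sqnorm_eq0.
by apply: (mulfI s0); rewrite -sqnormM !divff// sqnorm1.
Qed.

Lemma sqnorm_normr (R : realType) (z : R[i]) : `|z| ^+ 2 = (sqnorm z)%:C%C.
Proof. by rewrite -add_Re2_Im2. Qed.

Lemma ltr_sqnorm (R : realType) (z : R[i]) (e : R) :
  0 < e -> (`|z| < e%:C%C) = (sqnorm z < e ^+ 2).
Proof.
move=> e0; rewrite -(@ltr_pXn2r _ 2)// ?nnegrE//; last by rewrite ler0c ltW.
by rewrite sqnorm_normr -rmorphXn/= ltcR.
Qed.

Lemma gt0_complexE (R : realType) (e : R[i]) : 0 < e -> exists2 r, 0 < r & e = r%:C%C.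
Proof.
by case: e => x y; rewrite ltcE /= => /andP[/eqP -> x0]; exists x.
Qed.

(** Type class search computes these neighbourhood systems too far to recognize
   that they are filters. *)
#[local] Instance nbhs_filter_C (R : realType) (z : R[i]) : Filter (nbhs z).
Proof. exact: nbhs_filter. Qed.

#[local] Instance nbhs_filter_rV (R : realType) m (a : 'rV[R[i]]_m) :
  Filter (nbhs a).
Proof. exact: nbhs_filter. Qed.

#[local] Instance nbhs_filter_real_rV (R : realType) m (a : 'rV[R]_m) :
  Filter (nbhs a).
Proof. exact: nbhs_filter. Qed.

Lemma ReI_continuous (R : realType) (z : R[i]) :
  {for z, continuous (@complex.Re R)} /\ {for z, continuous (@complex.Im R)}.
Proof.
have step (F : R[i] -> R) : (forall w, (F z - F w) ^+ 2 <= sqnorm (z - w)) ->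
    {for z, continuous F}.
  move=> hF; apply/(@cvgrPdist_lt R R^o _ _ (nbhs_filter z)) => e e0.
  have eC : 0 < e%:C%C by rewrite ltcR.
  have h : nbhs z (ball z e%:C%C) by apply/nbhs_ballP; exists e%:C%C.
  apply: filterS h => w; rewrite -ball_normE /ball_ /= ltr_sqnorm// => h.
  rewrite -(@ltr_pXn2r _ 2)// ?nnegrE ?(ltW e0)// real_normK ?num_real//.
  exact: le_lt_trans (hF w) h.
by split; apply: step => w;
  rewrite /sqnorm ReD ReN ImD ImN ?lerDl ?lerDr sqr_ge0.
Qed.

Lemma Complex_cvg (R : realType) (T : Type) (F : set_system T)
    (FF : Filter F) (g : T -> R[i]) (l : R[i]) :
  Re (g x) @[x --> F] --> Re l -> Im (g x) @[x --> F] --> Im l ->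
  g x @[x --> F] --> l.
Proof.
move=> /(@cvgrPdist_lt R R^o) hr /(@cvgrPdist_lt R R^o) hi.
apply/(@cvgrPdist_lt _ R[i]^o) => e /gt0_complexE[r r0 ->].
have r2 : 0 < r / 2 by rewrite divr_gt0.
near=> x; rewrite ltr_sqnorm// /sqnorm ReD ReN ImD ImN.
have a1 : `|Re l - Re (g x)| < r / 2 by near: x; exact: hr.
have a2 : `|Im l - Im (g x)| < r / 2 by near: x; exact: hi.
rewrite -(real_normK (num_real (_ - _))) -(real_normK (num_real (Im l - _))).
have := normr_ge0 (Re l - Re (g x)); have := normr_ge0 (Im l - Im (g x)).
by nra.
Unshelve. all: by end_near. Qed.

Lemma Re_cvg (R : realType) (T : Type) (F : set_system T)
    (FF : Filter F) (g : T -> R[i]) (l : R[i]) :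
  g x @[x --> F] --> l -> Re (g x) @[x --> F] --> Re l.
Proof. by move=> h; apply: (cvg_comp _ _ h); exact: (ReI_continuous l).1. Qed.

Lemma Im_cvg (R : realType) (T : Type) (F : set_system T)
    (FF : Filter F) (g : T -> R[i]) (l : R[i]) :
  g x @[x --> F] --> l -> Im (g x) @[x --> F] --> Im l.
Proof. by move=> h; apply: (cvg_comp _ _ h); exact: (ReI_continuous l).2. Qed.

Lemma real_complex_continuous (R : realType) : continuous (fun x : R => x%:C%C).
Proof.
by move=> x; apply: Complex_cvg => /=; [exact: cvg_id|exact: cvg_cst].
Qed.

Lemma Re_conj (R : realType) (z : R[i]) : Re (conjc z) = Re z.
Proof. by case: z. Qed.

Lemma Im_conj (R : realType) (z : R[i]) : Im (conjc z) = - Im z.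
Proof. by case: z. Qed.

Lemma conjcD (R : realType) (z w : R[i]) : conjc (z + w) = conjc z + conjc w.
Proof. exact: rmorphD. Qed.

Lemma conjcM (R : realType) (z w : R[i]) : conjc (z * w) = conjc z * conjc w.
Proof. exact: rmorphM. Qed.

Lemma conjc_cvg (R : realType) (T : Type) (F : set_system T)
    (FF : Filter F) (g : T -> R[i]) (l : R[i]) :
  g x @[x --> F] --> l -> conjc (g x) @[x --> F] --> conjc l.
Proof.
move=> h; apply: Complex_cvg.
  by under eq_fun do rewrite Re_conj; rewrite Re_conj; exact: Re_cvg.
under eq_fun do rewrite Im_conj; rewrite Im_conj.
by apply: (@cvgN R R^o); exact: Im_cvg.
Qed.

Lemma rV_cvg (K : topologicalType) (T : Type) (F : set_system T)
    (FF : Filter F) (m : nat) (g : T -> 'rV[K]_m) (l : 'rV[K]_m) :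
  (forall k, g x 0 k @[x --> F] --> l 0 k) -> g x @[x --> F] --> l.
Proof.
move=> h A [P hP hA]; rewrite /= /nbhs /=.
apply: filterS (fun x (H : forall ij, P ij.1 ij.2 (g x ij.1 ij.2)) =>
  hA _ (fun i j => H (i, j))) _.
apply: filter_forall => -[i j] /=; rewrite ord1.
by apply: h; have := hP 0 j.
Qed.

Lemma rV_coord_cvg (K : topologicalType) (T : Type) (F : set_system T)
    (FF : Filter F) (m : nat) (g : T -> 'rV[K]_m) (l : 'rV[K]_m) (k : 'I_m) :
  g x @[x --> F] --> l -> g x 0 k @[x --> F] --> l 0 k.
Proof.
move=> h A hA; have := h [set w | A (w 0 k)]; apply.
exists (fun i j => if j == k then A else setT) => [i j|w /(_ 0 k)] /=; last first.
  by rewrite eqxx.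
case: eqP => [->|_]; last exact: filterT.
by rewrite ord1.
Qed.

Lemma open_preim (T U : topologicalType) (W : set T) (V : set U) (F : T -> U) :
  open W -> open V -> (forall a, W a -> F x @[x --> a] --> F a) ->
  open (W `&` F @^-1` V).
Proof.
move=> oW oV cF; rewrite openE => a [Wa Va]; apply: filterI.
  exact: open_nbhs_nbhs.
by apply: cF => //; exact: open_nbhs_nbhs.
Qed.

Lemma sqnorm_cvg (R : realType) (T : Type) (F : set_system T) (FF : Filter F)
    (g : T -> R[i]) (l : R[i]) :
  g x @[x --> F] --> l -> sqnorm (g x) @[x --> F] --> sqnorm l.
Proof.
move=> h; have hr := Re_cvg FF h; have hi := Im_cvg FF h.
exact: (@cvgD R R^o _ _ _ _ _ _ _ (@cvgM R _ _ _ _ _ _ _ hr hr)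
  (@cvgM R _ _ _ _ _ _ _ hi hi)).
Qed.

Lemma open_neq0 (R : realType) m (W : set 'rV[R[i]]_m) (h : 'rV[R[i]]_m -> R[i]) :
  open W -> (forall a, W a -> h x @[x --> a] --> h a) ->
  open (W `&` [set a | h a != 0]).
Proof.
move=> oW ch.
have -> : [set a | h a != 0] = (fun a => sqnorm (h a)) @^-1` [set x | x != 0].
  by apply/seteqP; split=> a /=; rewrite sqnorm_eq0.
apply: (open_preim oW (@open_neq R 0)) => a Wa.
by apply: sqnorm_cvg; exact: ch.
Qed.

(** * Derivatives of complex-valued functions of a real variable *)

Definition cder (R : realType) (c : R -> R[i]) (x : R) (l : R[i]) : Prop :=
  is_derive x 1 (fun y => Re (c y)) (Re l) /\
  is_derive x 1 (fun y => Im (c y)) (Im l).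

Lemma cder_uniq (R : realType) (c : R -> R[i]) x l l' :
  cder c x l -> cder c x l' -> l = l'.
Proof.
by move=> [[_ h1] [_ h2]] [[_ h3] [_ h4]]; apply: Complex_inj; rewrite -?h1 -?h2.
Qed.

Lemma cder_eqval (R : realType) (c : R -> R[i]) x l l' :
  cder c x l -> l = l' -> cder c x l'.
Proof. by move=> h <-. Qed.

Lemma cder_near (R : realType) (c d : R -> R[i]) x l :
  (\forall y \near x, c y = d y) -> cder c x l -> cder d x l.
Proof.
by move=> h [h1 h2]; split; [apply: near_eq_is_derive h1|apply: near_eq_is_derive h2];
  apply: filterS h => y ->.
Qed.

Lemma is_derive_cont (R : realType) (f : R -> R) (x l : R) :
  is_derive x 1 f l -> {for x, continuous f}.
Proof.
by move=> [h _]; apply: differentiable_continuous; exact/derivable1_diffP.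
Qed.

Lemma cder_cont (R : realType) (c : R -> R[i]) x l :
  cder c x l -> c y @[y --> x] --> c x.
Proof.
move=> [h1 h2]; apply: Complex_cvg; first exact: is_derive_cont h1.
exact: is_derive_cont h2.
Qed.

Lemma cder_cst (R : realType) (z : R[i]) x : cder (fun=> z) x 0.
Proof. by split; exact: is_derive_cst. Qed.

Lemma cder_real (R : realType) (f : R -> R) (x l : R) :
  is_derive x 1 f l -> cder (fun y => (f y)%:C%C) x l%:C%C.
Proof. by move=> h; split => //=; exact: is_derive_cst. Qed.

Lemma cderD (R : realType) (c d : R -> R[i]) x l l' :
  cder c x l -> cder d x l' -> cder (fun y => c y + d y) x (l + l').
Proof.
move=> [h1 h2] [h3 h4]; split.
  by under eq_fun do rewrite ReD; rewrite ReD; exact: is_deriveD.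
by under eq_fun do rewrite ImD; rewrite ImD; exact: is_deriveD.
Qed.

Lemma cder_sum (R : realType) (I : Type) (s : seq I) (c : I -> R -> R[i]) x
    (l : I -> R[i]) :
  (forall i, cder (c i) x (l i)) ->
  cder (fun y => \sum_(i <- s) c i y) x (\sum_(i <- s) l i).
Proof.
move=> h; elim: s => [|i s ih].
  by under eq_fun do rewrite big_nil; rewrite big_nil; exact: cder_cst.
by under eq_fun do rewrite big_cons; rewrite big_cons; exact: cderD.
Qed.

Lemma cderM (R : realType) (c d : R -> R[i]) x l l' :
  cder c x l -> cder d x l' ->
  cder (fun y => c y * d y) x (l * d x + c x * l').
Proof.
move=> [h1 h2] [h3 h4]; split.
  under eq_fun do rewrite ReM; apply: is_derive_eq.
  by rewrite ReD !ReM /GRing.scale/=; ring.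
under eq_fun do rewrite ImM; apply: is_derive_eq.
by rewrite ImD !ImM /GRing.scale/=; ring.
Qed.

Lemma cder_conj (R : realType) (c : R -> R[i]) x l :
  cder c x l -> cder (fun y => conjc (c y)) x (conjc l).
Proof.
move=> [h1 h2]; split.
  by under eq_fun do rewrite Re_conj; rewrite Re_conj.
by under eq_fun do rewrite Im_conj; rewrite Im_conj; exact: is_deriveN.
Qed.

Lemma invcE (R : realType) (z : R[i]) : z^-1 = conjc z * (sqnorm z)^-1%:C%C.
Proof.
have [->|z0] := eqVneq z 0.
  by rewrite invr0 conjc0 mul0r.
apply: (mulfI z0); rewrite divff// mulrA -sqnormC -rmorphM/= divff//.
by rewrite sqnorm_eq0.
Qed.

Lemma cder_sqnorm (R : realType) (c : R -> R[i]) x l : cder c x l ->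
  is_derive x 1 (fun y => sqnorm (c y)) (2 * Re (conjc (c x) * l)).
Proof.
move=> [h1 h2]; rewrite /sqnorm; apply: is_derive_eq.
by rewrite ReM Re_conj Im_conj /GRing.scale/=; ring.
Qed.

Lemma cderV (R : realType) (c : R -> R[i]) x l :
  c x != 0 -> cder c x l -> cder (fun y => (c y)^-1) x (- l / c x ^+ 2).
Proof.
move=> cx0 h; have s0 : sqnorm (c x) != 0 by rewrite sqnorm_eq0.
under eq_fun do rewrite invcE.
have h' := @is_deriveV R (fun y => sqnorm (c y)) x _ 1 s0 (cder_sqnorm h).
apply: cder_eqval (cderM (cder_conj h) (cder_real h')) _.
have -> : - l / c x ^+ 2 = - l * (conjc (c x) * (sqnorm (c x))^-1%:C%C) ^+ 2.
  by rewrite -exprVn invcE.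
have -> : - sqnorm (c x) ^- 2 = - (sqnorm (c x))^-1 * (sqnorm (c x))^-1.
  by rewrite -exprVn expr2 mulNr.
set S := (sqnorm (c x))^-1.
have eS : S = S * S * sqnorm (c x) by rewrite -mulrA mulVf ?mulr1.
rewrite [X in conjc l * X%:C%C]eS /GRing.scale/=.
move: S {eS s0 h' cx0} => S; rewrite /sqnorm.
by apply: Complex_inj; case: (c x) l {h} => a b [p q] /=; ring.
Qed.

Lemma cder_ln (R : realType) (f : R -> R) (x l : R) :
  0 < f x -> is_derive x 1 f l -> is_derive x 1 (fun y => ln (f y)) (l / f x).
Proof.
move=> fx0 h; rewrite mulrC.
exact: (is_derive1_comp (f := @ln R) (is_derive1_ln fx0) h).
Qed.

Lemma cder_id (R : realType) (v : R[i]) x : cder (fun y => y%:C%C * v) x v.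
Proof.
apply: cder_eqval (cderM (cder_real (is_derive_id x 1)) (cder_cst v x)) _.
by rewrite mulr0 addr0 mul1r.
Qed.

(** * Directional derivatives and the chain rule *)

Lemma rderive_cder (R : realType) m (g : 'rV[R[i]]_m -> R[i]) v a :
  rderivable g v a -> cder (fun x : R => g (a + x%:C%C *: v)) 0 (rderive g v a).
Proof.
by move=> [h1 h2]; split; rewrite /= derive1E; exact: derivableP.
Qed.

Lemma cder_rderive (R : realType) m (g : 'rV[R[i]]_m -> R[i]) v a l :
  cder (fun x : R => g (a + x%:C%C *: v)) 0 l ->
  rderivable g v a /\ rderive g v a = l.
Proof.
move=> [h1 h2]; have [h3 h4] := h1; have [h5 h6] := h2.
by split=> //; apply: Complex_inj => /=; rewrite derive1E derive_val.
Qed.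

Lemma is_derive_shift0 (R : realType) (f : R -> R) (x l : R) :
  is_derive (0 : R) 1 (fun y => f (x + y)) l -> is_derive x 1 f l.
Proof.
move=> h; have e : f = (fun y => f (x + y)) \o (fun y => y - x).
  by apply/funext => y /=; rewrite subrKC.
have h' : is_derive (x - x) 1 (fun y => f (x + y)) l by rewrite subrr.
have hs : is_derive x 1 (fun y => y - x) 1.
  by have := is_deriveB (is_derive_id x 1) (is_derive_cst x x 1); rewrite subr0.
by rewrite e -[l]mulr1; exact: (@is_derive1_comp R _ _ x l 1 h' hs).
Qed.

Lemma is_derive_0P (R : realType) (f : R -> R) (l : R) :
  x^-1 * (f x - f 0) @[x --> 0^'] --> l -> is_derive (0 : R) 1 f l.
Proof.
have e : (fun x : R => x^-1 * (f x - f 0)) =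
         (fun h : R => h^-1 *: ((f \o shift 0) (h *: 1) - f 0)).
  by apply/funext => x /=; rewrite addr0 [x *: 1]mulr1.
rewrite e => h; apply: DeriveDef; last exact: (cvg_lim _ h).
by apply/cvg_ex; exists l.
Qed.

(** At a zero of h the difference quotient of h E is that of h times E. *)
Lemma is_derive_mul_cont (R : realType) (h E : R -> R) (dh : R) :
  h 0 = 0 -> is_derive (0 : R) 1 h dh -> {for 0, continuous E} ->
  is_derive (0 : R) 1 (fun x => h x * E x) (dh * E 0).
Proof.
move=> h0 hd hE; apply: is_derive_0P; rewrite h0 mul0r.
have e : (fun x : R => x^-1 * (h x * E x - 0)) =
         (fun x => (x^-1 * (h x - h 0)) * E x).
  by apply/funext => x; rewrite h0 !subr0 mulrA.
rewrite e; apply: (@cvgM R); last exact: cvg_within_filter hE.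
have [h1 <-] := hd.
have -> : (fun x : R => x^-1 * (h x - h 0)) =
         (fun y : R => y^-1 *: ((h \o shift 0) (y *: 1) - h 0)).
  by apply/funext => x /=; rewrite addr0 [x *: 1]mulr1.
exact: h1.
Qed.

(** The mean value theorem on the segment from 0 to t, whatever the sign of t. *)
Lemma MVT_sym (R : realType) (f df : R -> R) (t : R) :
  (forall y : R, `|y| <= `|t| -> is_derive y 1 f (df y)) ->
  exists2 y, `|y| <= `|t| & f t - f 0 = df y * t.
Proof.
move=> h; have cont (A : interval R) : {subset A <= [pred y | `|y| <= `|t|]} ->
    {within [set` A], continuous f}.
  move=> hA; apply: continuous_in_subspaceT => y; rewrite inE /= => /hA yt.
  exact: is_derive_cont (h _ yt).
have [t0|t0] := leP 0 t.
  have i y : y \in `[0, t] -> `|y| <= `|t|.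
    by rewrite in_itv /= => /andP[y0 yt]; rewrite !ger0_norm.
  have [|y yt ->] := @MVT_segment R f df 0 t t0 _ (cont _ i).
    by move=> x xt; apply: h; apply: i; rewrite in_itv /= !ltW ?(itvP xt).
  by exists y; rewrite ?subr0//; exact: i.
have i y : y \in `[t, 0] -> `|y| <= `|t|.
  by rewrite in_itv /= => /andP[y0 yt]; rewrite !ler0_norm ?lerN2// ltW.
have [|y yt e] := @MVT_segment R f df t 0 (ltW t0) _ (cont _ i).
  by move=> x xt; apply: h; apply: i; rewrite in_itv /= !ltW ?(itvP xt).
exists y; first exact: i.
by rewrite -opprB e sub0r mulrN opprK.
Qed.

Lemma is_derive_line (R : realType) m (W : set 'rV[R[i]]_m)
    (F D : 'rV[R[i]]_m -> R) (v b : 'rV[R[i]]_m) (s : R) :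
  (forall p, W p -> is_derive (0 : R) 1 (fun x : R => F (p + x%:C%C *: v)) (D p)) ->
  W (b + s%:C%C *: v) ->
  is_derive s 1 (fun x : R => F (b + x%:C%C *: v)) (D (b + s%:C%C *: v)).
Proof.
move=> dF Ws; have := dF _ Ws.
rewrite (_ : (fun t : R => F (_ + _)) =
  fun t => F (b + (s + t)%:C%C *: v)); last first.
  by apply/funext => t; rewrite rmorphD /= scalerDl addrA.
exact: (@is_derive_shift0 R (fun y => F (b + y%:C%C *: v))).
Qed.

(** The increment is, by the mean value theorem, the product of h with a value
   of D at a point that tends to a. *)
Lemma is_derive_incr (R : realType) m (W : set 'rV[R[i]]_m)
    (F D : 'rV[R[i]]_m -> R) v a (b : R -> 'rV[R[i]]_m) (h : R -> R) (dh : R) :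
  open W -> W a ->
  (forall p, W p -> is_derive (0 : R) 1 (fun x : R => F (p + x%:C%C *: v)) (D p)) ->
  {for a, continuous D} -> b x @[x --> (0 : R)] --> a -> b 0 = a ->
  h 0 = 0 -> is_derive (0 : R) 1 h dh ->
  is_derive (0 : R) 1 (fun x => F (b x + (h x)%:C%C *: v) - F (b x)) (dh * D a).
Proof.
move=> oW Wa dF cD cb b0 h0 hd.
pose E x := if h x == 0 then D a else (F (b x + (h x)%:C%C *: v) - F (b x)) / h x.
have hE x : F (b x + (h x)%:C%C *: v) - F (b x) = h x * E x.
  rewrite /E; case: eqP => [->|/eqP hx]; first by rewrite scale0r addr0 subrr mul0r.
  by rewrite mulrC divfK.
have E0 : E 0 = D a by rewrite /E h0 eqxx.
under eq_fun do rewrite hE.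
rewrite -E0; apply: is_derive_mul_cont => //.
have close A : nbhs a A -> \forall x \near (0 : R),
    forall y : R, `|y| <= `|h x| -> A (b x + y%:C%C *: v).
  move=> aA.
  have c2 : (fun xy : R * R => b xy.1 + xy.2%:C%C *: v) @ (nbhs (0 : R), nbhs (0 : R))
      --> a.
    apply: rV_cvg => k.
    under eq_fun do rewrite !mxE.
    rewrite -[a 0 k]addr0; apply: (@cvgD _ R[i]^o).
      have cbk : b x 0 k @[x --> (0 : R)] --> a 0 k.
        exact: rV_coord_cvg.
      exact: (cvg_comp fst (fun x => b x 0 k) (@cvg_fst _ _ _ _ _) cbk).
    rewrite -[0 in X in _ --> X](mul0r (v 0 k)); apply: (@cvgM R[i]); last exact: cvg_cst.
    exact: (cvg_comp snd (fun y : R => y%:C%C) (@cvg_snd _ _ _ _ _)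
      (@real_complex_continuous R 0)).
  have [[P Q] /= [hP hQ] PQ] := c2 _ aA.
  have /nbhs_ballP[e /= e0 eQ] := hQ.
  have hc := is_derive_cont hd.
  near=> x => y yh; apply: (PQ (x, y)); split=> /=; first by near: x.
  apply: eQ; rewrite -ball_normE /ball_ /= sub0r normrN; apply: le_lt_trans yh _.
  rewrite -[h x]subr0 -h0 distrC; near: x.
  exact: (@cvgr_dist_lt R R^o _ _ _ _ _ hc).
suff : E x @[x --> (0 : R)] --> D a by rewrite -E0.
apply/(@cvgrPdist_lt R R^o _ _ (nbhs_filter 0)) => e e0.
have aA : nbhs a (W `&` [set p | `|D a - D p| < e]).
  apply: filterI; first exact: open_nbhs_nbhs.
  exact: (@cvgr_dist_lt R R^o _ _ _ _ _ cD).
have := close _ aA; apply: filterS => x hx.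
rewrite /E; case: eqP => [_|/eqP hx0]; first by rewrite subrr normr0.
have [|y yh e1] := @MVT_sym R (fun y => F (b x + y%:C%C *: v))
    (fun y => D (b x + y%:C%C *: v)) (h x).
  by move=> y yh; apply: (is_derive_line dF); exact: (hx _ yh).1.
move: e1; rewrite scale0r addr0 => ->; rewrite mulfK//.
by have [_] := hx _ yh.
Unshelve. all: by end_near. Qed.

(** Moving away from a in one direction v_i after the other reduces the chain rule
   to the increments of is_derive_incr.  Continuity of the directional
   derivatives is what makes a C^1 function totally differentiable here. *)
Lemma is_derive_chain_seq (R : realType) m (W : set 'rV[R[i]]_m)
    (F : 'rV[R[i]]_m -> R) (D : 'rV[R[i]]_m -> 'rV[R[i]]_m -> R) a
    (I : Type) (s : seq I) (v : I -> 'rV[R[i]]_m) (h : I -> R -> R) (dh : I -> R) :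
  open W -> W a ->
  (forall w p, W p -> is_derive (0 : R) 1 (fun x : R => F (p + x%:C%C *: w)) (D w p)) ->
  (forall w, {for a, continuous (D w)}) ->
  (forall i, h i 0 = 0) -> (forall i, is_derive (0 : R) 1 (h i) (dh i)) ->
  is_derive (0 : R) 1 (fun x => F (a + \sum_(i <- s) (h i x)%:C%C *: v i))
    (\sum_(i <- s) dh i * D (v i) a).
Proof.
move=> oW Wa dF cD h0 hd; elim: s => [|i s ih].
  under eq_fun do rewrite big_nil addr0.
  by rewrite big_nil; exact: is_derive_cst.
under eq_fun do rewrite big_cons.
rewrite big_cons.
pose b x := a + \sum_(j <- s) (h j x)%:C%C *: v j.
have b0 : b 0 = a.
  by rewrite /b big1 ?addr0// => j _; rewrite h0 scale0r.
have cb : b x @[x --> (0 : R)] --> a.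
  apply: rV_cvg => k; rewrite -b0.
  have e : (fun x => b x 0 k) = fun x => a 0 k + \sum_(j <- s) (h j x)%:C%C * v j 0 k.
    apply/funext => x; rewrite !mxE summxE; congr (_ + _).
    by apply: eq_bigr => j _; rewrite mxE.
  apply: (@cder_cont _ (fun x => b x 0 k) 0
    (0 + \sum_(j <- s) ((dh j)%:C%C * v j 0 k + (h j 0)%:C%C * 0))).
  rewrite e; apply: cderD; first exact: cder_cst.
  by apply: cder_sum => j; apply: cderM; [exact: cder_real|exact: cder_cst].
have h1 := is_derive_incr oW Wa (dF (v i)) (cD (v i)) cb b0 (h0 i) (hd i).
have -> : (fun x : R => F (a + ((h i x)%:C%C *: v i +
      \sum_(j <- s) (h j x)%:C%C *: v j))) =
    fun x => (F (b x + (h i x)%:C%C *: v i) - F (b x)) + F (b x).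
  by apply/funext => x; rewrite subrK /b -addrA [_ *: _ + _]addrC.
exact: is_deriveD.
Qed.

(** The basis e_k, i e_k of C^m over the reals, and the coordinates in it. *)
Definition real_dir (R : realType) m (kb : 'I_m * bool) : 'rV[R[i]]_m :=
  if kb.2 then delta_mx 0 kb.1 else 'i%C *: delta_mx 0 kb.1.

Definition real_coef (R : realType) m (w : 'rV[R[i]]_m) (kb : 'I_m * bool) : R :=
  if kb.2 then Re (w 0 kb.1) else Im (w 0 kb.1).

Lemma real_dirE (R : realType) m (w : 'rV[R[i]]_m) :
  w = \sum_(kb : 'I_m * bool) (real_coef w kb)%:C%C *: real_dir R kb.
Proof.
rewrite -(pair_bigA_idem _ (fun k b =>
  (real_coef w (k, b))%:C%C *: real_dir R (k, b)))/=; last exact: addr0.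
rewrite {1}[w]row_sum_delta; apply: eq_bigr => k _.
rewrite big_bool /= /real_coef /real_dir /= scalerA -scalerDl.
by congr (_ *: _); apply: Complex_inj; case: (w 0 k) => x y /=; ring.
Qed.

Lemma CkS_cder (R : realType) m k (W : set 'rV[R[i]]_m) g :
  Ck k.+1 W g -> forall v a, W a ->
  cder (fun x : R => g (a + x%:C%C *: v)) 0 (rderive g v a).
Proof. by move=> [_ h] v a Wa; apply: rderive_cder; have [+ _] := h v; exact. Qed.

Lemma Ck_cont (R : realType) m k (W : set 'rV[R[i]]_m) g a :
  Ck k W g -> W a -> g x @[x --> a] --> g a.
Proof. by case: k => [|k] [h _] Wa; exact: h. Qed.

(** The differential of a C^1 function is the sum of a complex linear and a
   complex antilinear form, whose coefficients are the values of dz and dzbar. *)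
Lemma cder_chain (R : realType) m (W : set 'rV[R[i]]_m) g
    (c : R -> 'rV[R[i]]_m) (dc : 'rV[R[i]]_m) :
  open W -> Ck 1 W g -> W (c 0) ->
  (forall k, cder (fun x => c x 0 k) 0 (dc 0 k)) ->
  cder (fun x => g (c x)) 0
    (\sum_k (dc 0 k * dz k g (c 0) + conjc (dc 0 k) * dzbar k g (c 0))).
Proof.
move=> oW hg Wa hc; set a := c 0.
pose h (kb : 'I_m * bool) x := real_coef (c x - a) kb.
have hcE k (x : R) : (c x - a) 0 k = c x 0 k - a 0 k by rewrite !mxE.
have e x : c x = a + \sum_kb (h kb x)%:C%C *: real_dir R kb.
  by rewrite -real_dirE subrKC.
have h0 kb : h kb 0 = 0.
  by rewrite /h subrr /real_coef !mxE; case: ifP.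
have hd kb : is_derive (0 : R) 1 (h kb) (real_coef dc kb).
  have [hr hi] := cderD (hc kb.1) (cder_cst (- a 0 kb.1) 0).
  rewrite addr0 in hr hi; rewrite /h /real_coef.
  by case: kb.2; under eq_fun do rewrite hcE.
have hcont v := (hg.2 v).2.1 a Wa.
have hre := @is_derive_chain_seq R m W (fun p => Re (g p))
  (fun v p => Re (rderive g v p)) a _ (index_enum _) (@real_dir R m) h _ oW Wa
  (fun v p Wp => (CkS_cder hg v Wp).1) (fun v => Re_cvg _ (hcont v)) h0 hd.
have him := @is_derive_chain_seq R m W (fun p => Im (g p))
  (fun v p => Im (rderive g v p)) a _ (index_enum _) (@real_dir R m) h _ oW Wa
  (fun v p Wp => (CkS_cder hg v Wp).2) (fun v => Im_cvg _ (hcont v)) h0 hd.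
have key : \sum_k (dc 0 k * dz k g a + conjc (dc 0 k) * dzbar k g a) =
    \sum_kb (real_coef dc kb)%:C%C * rderive g (real_dir R kb) a.
  rewrite -(pair_bigA_idem _ (fun k b => (real_coef dc (k, b))%:C%C *
    rderive g (real_dir R (k, b)) a))/=; last exact: addr0.
  apply: eq_bigr => k _; rewrite big_bool /= /real_coef /real_dir /= /dz /dzbar.
  set A := rderive g _ a; set B := rderive g _ a.
  have -> z : z * ((A - 'i%C * B) / 2) + conjc z * ((A + 'i%C * B) / 2) =
     (z + conjc z) / 2 * A + ((conjc z - z) / 2 * 'i%C) * B by move=> *; ring.
  by rewrite -ReJ_add -ImJ_sub.
have -> : (fun x => g (c x)) = fun x => g (a + \sum_kb (h kb x)%:C%C *: real_dir R kb).
  by apply/funext => x; rewrite -e.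
rewrite key; split.
  rewrite Re_sum (eq_bigr (fun kb => real_coef dc kb * Re (rderive g (real_dir R kb) a))).
    exact: hre.
  by move=> kb _; rewrite ReM /= mul0r subr0.
rewrite Im_sum (eq_bigr (fun kb => real_coef dc kb * Im (rderive g (real_dir R kb) a))).
  exact: him.
by move=> kb _; rewrite ImM /= mul0r addr0.
Qed.

(** * Smooth and holomorphic functions *)

Lemma open_line (R : realType) m (W : set 'rV[R[i]]_m) a v :
  open W -> W a -> \forall x \near (0 : R), W (a + x%:C%C *: v).
Proof.
move=> oW Wa; have c : (fun x : R => a + x%:C%C *: v) @ (0 : R) --> a.
  apply: rV_cvg => k; under eq_fun do rewrite !mxE.
  have := cder_cont (cderD (cder_cst (a 0 k) (0 : R)) (cder_id (v 0 k) 0)).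
  by rewrite mul0r addr0.
by apply: c; apply: open_nbhs_nbhs.
Qed.

Lemma cder_line_ext (R : realType) m (W : set 'rV[R[i]]_m)
    (g g' : 'rV[R[i]]_m -> R[i]) a v l :
  open W -> W a -> (forall b, W b -> g b = g' b) ->
  cder (fun x : R => g (a + x%:C%C *: v)) 0 l ->
  cder (fun x : R => g' (a + x%:C%C *: v)) 0 l.
Proof.
move=> oW Wa e; apply: cder_near.
by apply: filterS (open_line v oW Wa) => x /e.
Qed.

Lemma cvg_open_ext (R : realType) m (W : set 'rV[R[i]]_m)
    (g g' : 'rV[R[i]]_m -> R[i]) a :
  open W -> W a -> (forall b, W b -> g b = g' b) ->
  g x @[x --> a] --> g a -> g' x @[x --> a] --> g' a.
Proof.
move=> oW Wa e h A; rewrite -e// => /h hA.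
have WA : nbhs a (W `&` [set b | A (g b)]).
  by apply: filterI; [exact: open_nbhs_nbhs|exact: hA].
by apply: filterS WA => b [Wb]; rewrite /= e.
Qed.

Lemma CkS_Ck (R : realType) m k (W : set 'rV[R[i]]_m) g v :
  Ck k.+1 W g -> Ck k W (rderive g v).
Proof. by move=> [_ /(_ v)[]]. Qed.

Lemma Ck0I (R : realType) m (W : set 'rV[R[i]]_m) (g : 'rV[R[i]]_m -> R[i]) :
  (forall a, W a -> g x @[x --> a] --> g a) -> Ck 0 W g.
Proof. by move=> h; split; [exact: h|]. Qed.

Lemma Ck_ext (R : realType) m (W : set 'rV[R[i]]_m) : open W ->
  forall k (g g' : 'rV[R[i]]_m -> R[i]),
  (forall a, W a -> g a = g' a) -> Ck k W g -> Ck k W g'.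
Proof.
move=> oW; elim=> [|k ih] g g' e [c h].
  by split; [move=> a Wa; apply: (cvg_open_ext oW Wa e); exact: c|].
split; first by move=> a Wa; apply: (cvg_open_ext oW Wa e); exact: c.
have d v a : W a -> rderivable g' v a /\ rderive g' v a = rderive g v a.
  move=> Wa; apply/cder_rderive/(cder_line_ext oW Wa e)/rderive_cder.
  by have [+ _] := h v; exact.
move=> v; split; first by move=> a /(d v)[].
by apply: ih (h v).2 => a /(d v)[].
Qed.

Lemma CkSI (R : realType) m k (W : set 'rV[R[i]]_m)
    (g : 'rV[R[i]]_m -> R[i]) (G : 'rV[R[i]]_m -> 'rV[R[i]]_m -> R[i]) :
  open W ->
  (forall a, W a -> g x @[x --> a] --> g a) ->
  (forall v a, W a -> cder (fun x : R => g (a + x%:C%C *: v)) 0 (G v a)) ->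
  (forall v, Ck k W (G v)) -> Ck k.+1 W g.
Proof.
move=> oW c d h; split; [exact: c|] => v; split; first by move=> a /(d v)/cder_rderive[].
by apply: (Ck_ext oW _ (h v)) => a /(d v)/cder_rderive[].
Qed.

Lemma CkW (R : realType) m (W : set 'rV[R[i]]_m) k (g : 'rV[R[i]]_m -> R[i]) :
  Ck k.+1 W g -> Ck k W g.
Proof.
elim: k g => [|k ih] g [c h]; first by split; [exact: c|].
split; [exact: c|] => v; have [h1 h2] := h v; split; [exact: h1|exact: ih].
Qed.

Lemma Ck_sub (R : realType) m (W W' : set 'rV[R[i]]_m) k g :
  W' `<=` W -> Ck k W g -> Ck k W' g.
Proof.
move=> s; elim: k g => [|k ih] g [c h].
  by split; [move=> a /s/c|].
split; [by move=> a /s/c|] => v; have [h1 h2] := h v.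
by split; [move=> a /s/h1|exact: ih].
Qed.

Lemma Ck_cst (R : realType) m (W : set 'rV[R[i]]_m) k z :
  open W -> Ck k W (fun=> z).
Proof.
move=> oW; elim: k z => [|k ih] z; first by apply: Ck0I => a _; exact: cvg_cst.
apply: (@CkSI _ _ _ _ _ (fun _ _ => 0)) => //.
- by move=> a _; exact: cvg_cst.
- by move=> v a _; exact: cder_cst.
Qed.

Lemma Ck_coord (R : realType) m (W : set 'rV[R[i]]_m) k j :
  open W -> Ck k W (fun a => a 0 j).
Proof.
move=> oW; case: k => [|k].
  by apply: Ck0I => a _; apply: rV_coord_cvg; exact: cvg_id.
apply: (@CkSI _ _ _ _ _ (fun v _ => v 0 j)).
- exact: oW.
- by move=> a _; apply: rV_coord_cvg; exact: cvg_id.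
- move=> v a _; under eq_fun do rewrite !mxE.
  exact: (cder_eqval (cderD (cder_cst _ _) (cder_id _ _)) (add0r _)).
- by move=> v; exact: Ck_cst.
Qed.

Lemma CkD (R : realType) m (W : set 'rV[R[i]]_m) k g g' :
  open W -> Ck k W g -> Ck k W g' -> Ck k W (fun a => g a + g' a).
Proof.
move=> oW; elim: k g g' => [|k ih] g g' h h'.
  by apply: Ck0I => a Wa; apply: (@cvgD _ R[i]^o); [exact: h.1|exact: h'.1].
apply: (@CkSI _ _ _ _ _ (fun v a => rderive g v a + rderive g' v a)).
- exact: oW.
- by move=> a Wa; apply: (@cvgD _ R[i]^o); [exact: h.1|exact: h'.1].
- by move=> v a Wa; apply: cderD; [exact: (CkS_cder h)|exact: (CkS_cder h')].
- by move=> v; apply: ih; [exact: (CkS_Ck _ h)|exact: (CkS_Ck _ h')].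
Qed.

Lemma CkM (R : realType) m (W : set 'rV[R[i]]_m) k g g' :
  open W -> Ck k W g -> Ck k W g' -> Ck k W (fun a => g a * g' a).
Proof.
move=> oW; elim: k g g' => [|k ih] g g' h h'.
  by apply: Ck0I => a Wa; apply: (@cvgM R[i]); [exact: h.1|exact: h'.1].
apply: (@CkSI _ _ _ _ _ (fun v a => rderive g v a * g' a + g a * rderive g' v a)).
- exact: oW.
- by move=> a Wa; apply: (@cvgM R[i]); [exact: h.1|exact: h'.1].
- move=> v a Wa.
  have := cderM (CkS_cder h v Wa) (CkS_cder h' v Wa).
  by rewrite scale0r addr0.
- move=> v; apply: CkD => //; apply: ih.
  + exact: (CkS_Ck _ h).
  + exact: CkW.
  + exact: CkW.
  + exact: (CkS_Ck _ h').
Qed.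

Lemma Ck_sum (R : realType) m (W : set 'rV[R[i]]_m) k (I : Type) (s : seq I)
    (P : pred I) (g : I -> 'rV[R[i]]_m -> R[i]) :
  open W -> (forall i, P i -> Ck k W (g i)) ->
  Ck k W (fun a => \sum_(i <- s | P i) g i a).
Proof.
move=> oW h; elim: s => [|i s ih].
  by under eq_fun do rewrite big_nil; exact: Ck_cst.
under eq_fun do rewrite big_cons.
by case: (boolP (P i)) => // Pi; apply: CkD => //; exact: h.
Qed.

Lemma Ck_conj (R : realType) m (W : set 'rV[R[i]]_m) k g :
  open W -> Ck k W g -> Ck k W (fun a => conjc (g a)).
Proof.
move=> oW; elim: k g => [|k ih] g h.
  by apply: Ck0I => a Wa; apply: conjc_cvg; exact: h.1.
apply: (@CkSI _ _ _ _ _ (fun v a => conjc (rderive g v a))).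
- exact: oW.
- by move=> a Wa; apply: conjc_cvg; exact: h.1.
- by move=> v a Wa; apply: cder_conj; exact: (CkS_cder h).
- by move=> v; apply: ih; exact: (CkS_Ck _ h).
Qed.

Lemma CkV (R : realType) m (W : set 'rV[R[i]]_m) k g :
  open W -> (forall a, W a -> g a != 0) -> Ck k W g ->
  Ck k W (fun a => (g a)^-1).
Proof.
move=> oW g0; elim: k => [|k ih] h.
  by apply: Ck0I => a Wa; apply: (@cvgV R[i]); [exact: g0|exact: h.1].
apply: (@CkSI _ _ _ _ _ (fun v a => -1 * rderive g v a * ((g a)^-1 * (g a)^-1))).
- exact: oW.
- by move=> a Wa; apply: (@cvgV R[i]); [exact: g0|exact: h.1].
- move=> v a Wa.
  have e : a + (0 : R)%:C%C *: v = a by rewrite scale0r addr0.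
  have := @cderV _ (fun x : R => g (a + x%:C%C *: v)) 0 _ _ (CkS_cder h v Wa).
  by rewrite e expr2 invfM mulN1r; apply; exact: g0.
- move=> v; apply: CkM => //.
    by apply: CkM => //; [exact: Ck_cst|exact: (CkS_Ck _ h)].
  by apply: CkM => //; apply: ih; exact: CkW.
Qed.

Lemma Ck_dz (R : realType) m (W : set 'rV[R[i]]_m) k g j :
  open W -> Ck k.+1 W g -> Ck k W (dz j g) /\ Ck k W (dzbar j g).
Proof.
move=> oW h; have d v := CkS_Ck v h.
have c z v : Ck k W (fun a => z * rderive g v a).
  by apply: CkM => //; exact: Ck_cst.
have cc z z' : Ck k W (fun a => z * rderive g (delta_mx 0 j) a +
    z' * rderive g ('i%C *: delta_mx 0 j) a).
  by apply: CkD => //; exact: c.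
split.
  have e a : W a -> 2^-1 * rderive g (delta_mx 0 j) a +
      (- 'i%C / 2) * rderive g ('i%C *: delta_mx 0 j) a = dz j g a.
    by move=> _; rewrite /dz; move: (rderive _ _ _) (rderive _ _ _) => x y; ring.
  exact (Ck_ext oW e (cc (2^-1) (- 'i%C / 2))).
have e a : W a -> 2^-1 * rderive g (delta_mx 0 j) a +
    ('i%C / 2) * rderive g ('i%C *: delta_mx 0 j) a = dzbar j g a.
  by move=> _; rewrite /dzbar; move: (rderive _ _ _) (rderive _ _ _) => x y; ring.
exact (Ck_ext oW e (cc (2^-1) ('i%C / 2))).
Qed.

(** A derivative of g o F is a sum of products of derivatives of F and of the
   functions dz_j g o F and dzbar_j g o F, which are covered by the induction
   hypothesis. *)
Lemma Ck_comp (R : realType) m p (W : set 'rV[R[i]]_m) (V : set 'rV[R[i]]_p) k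
    (F : 'rV[R[i]]_m -> 'rV[R[i]]_p) g :
  open W -> open V -> (forall a, W a -> V (F a)) ->
  (forall j, Ck k W (fun a => F a 0 j)) -> Ck k V g -> Ck k W (fun a => g (F a)).
Proof.
move=> oW oV WV; elim: k g => [|k ih] g hF hg.
  apply: Ck0I => a Wa; have cF : F x @[x --> a] --> F a.
    by apply: rV_cvg => j; exact: ((hF j).1).
  exact: (cvg_comp F g cF (hg.1 _ (WV _ Wa))).
have C1 k' m' (W' : set 'rV[R[i]]_m') g' : Ck k'.+1 W' g' -> Ck 1 W' g'.
  by elim: k' => // k' ihk /CkW.
apply: (@CkSI _ _ _ _ _ (fun v a => \sum_j
   (rderive (fun b => F b 0 j) v a * dz j g (F a) +
    conjc (rderive (fun b => F b 0 j) v a) * dzbar j g (F a)))).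
- exact: oW.
- move=> a Wa; have cF : F x @[x --> a] --> F a.
    by apply: rV_cvg => j; exact: ((hF j).1).
  exact: (cvg_comp F g cF (hg.1 _ (WV _ Wa))).
- move=> v a Wa; have e : F (a + (0 : R)%:C%C *: v) = F a by rewrite scale0r addr0.
  have := @cder_chain _ _ V g (fun x : R => F (a + x%:C%C *: v))
    (\row_j rderive (fun b => F b 0 j) v a) oV (C1 _ _ _ _ hg).
  rewrite e => /(_ (WV _ Wa)) h; apply: (cder_eqval (h _) _).
    by move=> j; rewrite mxE; exact: (CkS_cder (hF j)).
  by apply: eq_bigr => j _; rewrite mxE.
- move=> v; apply: Ck_sum => // j _.
  have hd := CkS_Ck v (hF j); have [dg dg'] := Ck_dz j oV hg.
  have hF' i : Ck k W (fun a => F a 0 i) by apply: CkW.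
  apply: CkD => //; apply: CkM => //; [exact: ih|exact: Ck_conj|exact: ih].
Qed.

(** Differentials in Wirtinger form: the complex linear part p and the complex
   antilinear part q.  Holomorphy is the case q = 0, conjugation exchanges p and
   q, and a composition with a holomorphic map acts on both by its Jacobian. *)
Definition wdiff (R : realType) m (g : 'rV[R[i]]_m -> R[i]) (a : 'rV[R[i]]_m)
    (p q : 'I_m -> R[i]) : Prop :=
  forall v, cder (fun x : R => g (a + x%:C%C *: v)) 0
    (\sum_k (v 0 k * p k + conjc (v 0 k) * q k)).

Lemma line0 (R : realType) m (a v : 'rV[R[i]]_m) : a + (0 : R)%:C%C *: v = a.
Proof. by rewrite scale0r addr0. Qed.

Lemma wdiff_eq (R : realType) m (g : 'rV[R[i]]_m -> R[i]) a p q p' q' :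
  wdiff g a p q -> p =1 p' -> q =1 q' -> wdiff g a p' q'.
Proof. by move=> h /funext <- /funext <-. Qed.

Lemma wdiff_ext (R : realType) m (W : set 'rV[R[i]]_m) g g' a p q :
  open W -> W a -> (forall b, W b -> g b = g' b) ->
  wdiff g a p q -> wdiff g' a p q.
Proof. by move=> oW Wa e h v; exact: (cder_line_ext oW Wa e (h v)). Qed.

Lemma sum_delta (R : realType) m (j : 'I_m) (z : R[i]) (F : 'I_m -> R[i]) :
  \sum_k (z *: delta_mx 0 j : 'rV[R[i]]_m) 0 k * F k = z * F j.
Proof.
rewrite (bigD1 j)//= !mxE !eqxx mulr1 big1 ?addr0// => k kj.
by rewrite !mxE eqxx /= (negbTE kj) mulr0 mul0r.
Qed.

Lemma sum_conj_delta (R : realType) m (j : 'I_m) (z : R[i]) (F : 'I_m -> R[i]) :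
  \sum_k conjc ((z *: delta_mx 0 j : 'rV[R[i]]_m) 0 k) * F k = conjc z * F j.
Proof.
rewrite (bigD1 j)//= !mxE !eqxx mulr1 big1 ?addr0// => k kj.
by rewrite !mxE eqxx /= (negbTE kj) mulr0 conjc0 mul0r.
Qed.

Lemma sum_delta_wdiff (R : realType) m (j : 'I_m) (z : R[i]) (p q : 'I_m -> R[i]) :
  \sum_k ((z *: delta_mx 0 j : 'rV[R[i]]_m) 0 k * p k +
    conjc ((z *: delta_mx 0 j : 'rV[R[i]]_m) 0 k) * q k) = z * p j + conjc z * q j.
Proof. by rewrite big_split /= sum_delta sum_conj_delta. Qed.

Lemma wdiff_dz (R : realType) m (g : 'rV[R[i]]_m -> R[i]) a p q j :
  wdiff g a p q -> dz j g a = p j /\ dzbar j g a = q j.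
Proof.
move=> h; have e1 : rderive g (delta_mx 0 j) a = p j + q j.
  rewrite -[delta_mx _ _]scale1r (cder_rderive (h _)).2.
  by rewrite sum_delta_wdiff conjc1 !mul1r.
have e2 : rderive g ('i%C *: delta_mx 0 j) a = 'i%C * p j - 'i%C * q j.
  rewrite (cder_rderive (h _)).2 sum_delta_wdiff.
  by congr (_ + _); rewrite -mulNr; congr (_ * _); apply: Complex_inj => /=;
    rewrite ?oppr0.
have ii z : 'i%C * ('i%C * z) = - z :> R[i] by rewrite mulrA -expr2 sqr_i mulN1r.
rewrite /dz /dzbar e1 e2 mulrBr !ii; move: (p j) (q j) => x y.
have two0 : (2 : R[i]) != 0 by rewrite pnatr_eq0.
by split; apply: (mulIf two0); rewrite divfK//; ring.
Qed.

Lemma Ck_wdiff (R : realType) m (W : set 'rV[R[i]]_m) g a :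
  open W -> Ck 1 W g -> W a -> wdiff g a (fun k => dz k g a) (fun k => dzbar k g a).
Proof.
move=> oW hg Wa v.
have := @cder_chain _ _ W g (fun x : R => a + x%:C%C *: v) v oW hg.
rewrite line0 => /(_ Wa); apply=> k.
under eq_fun do rewrite !mxE.
exact: (cder_eqval (cderD (cder_cst _ _) (cder_id _ _)) (add0r _)).
Qed.

Lemma wdiff_cst (R : realType) m (z : R[i]) (a : 'rV[R[i]]_m) :
  wdiff (fun=> z) a (fun=> 0) (fun=> 0).
Proof.
move=> v; rewrite big1; first exact: cder_cst.
by move=> k _; rewrite !mulr0 addr0.
Qed.

Lemma wdiff_coord (R : realType) m j (a : 'rV[R[i]]_m) :
  wdiff (fun b => b 0 j) a (fun k => (k == j)%:R) (fun=> 0).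
Proof.
move=> v; under eq_fun do rewrite !mxE.
apply: (cder_eqval (cderD (cder_cst _ _) (cder_id _ _)) _).
rewrite add0r (bigD1 j)//= eqxx mulr1 mulr0 addr0 big1 ?addr0// => k kj.
by rewrite (negbTE kj) !mulr0 addr0.
Qed.

Lemma wdiffD (R : realType) m (g g' : 'rV[R[i]]_m -> R[i]) a p q p' q' :
  wdiff g a p q -> wdiff g' a p' q' ->
  wdiff (fun b => g b + g' b) a (fun k => p k + p' k) (fun k => q k + q' k).
Proof.
move=> h h' v; apply: (cder_eqval (cderD (h v) (h' v)) _).
by rewrite -big_split; apply: eq_bigr => k _ /=; ring.
Qed.

Lemma wdiffM (R : realType) m (g g' : 'rV[R[i]]_m -> R[i]) a p q p' q' :
  wdiff g a p q -> wdiff g' a p' q' ->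
  wdiff (fun b => g b * g' b) a (fun k => p k * g' a + g a * p' k)
    (fun k => q k * g' a + g a * q' k).
Proof.
move=> h h' v; apply: (cder_eqval (cderM (h v) (h' v)) _).
rewrite line0 mulr_suml mulr_sumr -big_split.
by apply: eq_bigr => k _ /=; ring.
Qed.

Lemma wdiff_sum (R : realType) m (I : Type) (s : seq I) (P : pred I)
    (g : I -> 'rV[R[i]]_m -> R[i]) a p q :
  (forall i, P i -> wdiff (g i) a (p i) (q i)) ->
  wdiff (fun b => \sum_(i <- s | P i) g i b) a (fun k => \sum_(i <- s | P i) p i k)
    (fun k => \sum_(i <- s | P i) q i k).
Proof.
move=> h; elim: s => [|i s ih].
  under eq_fun do rewrite big_nil; apply: (wdiff_eq (wdiff_cst 0 a)) => k;
    by rewrite big_nil.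
under eq_fun do rewrite big_cons; case: (boolP (P i)) => Pi.
  by apply: (wdiff_eq (wdiffD (h i Pi) ih)) => k; rewrite big_cons Pi.
by apply: (wdiff_eq ih) => k; rewrite big_cons (negbTE Pi).
Qed.

Lemma wdiff_conj (R : realType) m (g : 'rV[R[i]]_m -> R[i]) a p q :
  wdiff g a p q ->
  wdiff (fun b => conjc (g b)) a (fun k => conjc (q k)) (fun k => conjc (p k)).
Proof.
move=> h v; apply: (cder_eqval (cder_conj (h v)) _).
rewrite rmorph_sum /=; apply: eq_bigr => k _.
by rewrite rmorphD !rmorphM /= conjcK addrC.
Qed.

Lemma wdiffV (R : realType) m (g : 'rV[R[i]]_m -> R[i]) a p q :
  g a != 0 -> wdiff g a p q ->
  wdiff (fun b => (g b)^-1) a (fun k => - p k / g a ^+ 2) (fun k => - q k / g a ^+ 2).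
Proof.
move=> ga h v.
have := @cderV _ (fun x : R => g (a + x%:C%C *: v)) 0 _ _ (h v).
rewrite line0 => /(_ ga) h'; apply: (cder_eqval h' _).
by rewrite -sumrN mulr_suml; apply: eq_bigr => k _; ring.
Qed.

Lemma smooth_cont (R : realType) m (W : set 'rV[R[i]]_m) g a :
  smooth W g -> W a -> g x @[x --> a] --> g a.
Proof. by move=> h; exact: (Ck_cont (h 0%N)). Qed.

Lemma holoI (R : realType) m (W : set 'rV[R[i]]_m) (g : 'rV[R[i]]_m -> R[i]) :
  smooth W g -> (forall a, W a -> exists p, wdiff g a p (fun=> 0)) -> holo W g.
Proof.
by move=> sg h; split => // a /h[p hp] j; have [] := wdiff_dz j hp.
Qed.

Lemma holo_wdiff (R : realType) m (W : set 'rV[R[i]]_m) (g : 'rV[R[i]]_m -> R[i]) a :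
  open W -> holo W g -> W a -> wdiff g a (fun k => dz k g a) (fun=> 0).
Proof.
move=> oW [sg hg] Wa; apply: (wdiff_eq (Ck_wdiff oW (sg 1%N) Wa)) => // k.
exact: hg.
Qed.

Lemma holo_cont (R : realType) m (W : set 'rV[R[i]]_m) (g : 'rV[R[i]]_m -> R[i]) a :
  holo W g -> W a -> g x @[x --> a] --> g a.
Proof. by move=> [sg _]; exact: smooth_cont. Qed.

Lemma holo_sub (R : realType) m (W W' : set 'rV[R[i]]_m) (g : 'rV[R[i]]_m -> R[i]) :
  W' `<=` W -> holo W g -> holo W' g.
Proof.
by move=> s [h1 h2]; split => [k|a /s]; [exact: (Ck_sub s (h1 k))|exact: h2].
Qed.

Lemma holo_ext (R : realType) m (W : set 'rV[R[i]]_m) (g g' : 'rV[R[i]]_m -> R[i]) :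
  open W -> (forall a, W a -> g a = g' a) -> holo W g -> holo W g'.
Proof.
move=> oW e hg; apply: holoI => [k|a Wa]; first exact (Ck_ext oW e (hg.1 k)).
by exists (fun k => dz k g a); apply: (wdiff_ext oW Wa e _); exact: (holo_wdiff oW hg Wa).
Qed.

Lemma holo_cst (R : realType) m (W : set 'rV[R[i]]_m) z : open W -> holo W (fun=> z).
Proof.
move=> oW; apply: holoI => [k|a _]; first exact: Ck_cst.
by exists (fun=> 0); exact: wdiff_cst.
Qed.

Lemma holo_coord (R : realType) m (W : set 'rV[R[i]]_m) j :
  open W -> holo W (fun a => a 0 j).
Proof.
move=> oW; apply: holoI => [k|a _]; first exact: Ck_coord.
by eexists; exact: wdiff_coord.
Qed.

Lemma holoD (R : realType) m (W : set 'rV[R[i]]_m) g g' :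
  open W -> holo W g -> holo W g' -> holo W (fun a => g a + g' a).
Proof.
move=> oW h h'; apply: holoI => [k|a Wa]; first exact: (CkD oW (h.1 k) (h'.1 k)).
eexists; apply: (wdiff_eq (wdiffD (holo_wdiff oW h Wa) (holo_wdiff oW h' Wa))).
  by move=> k; reflexivity.
by move=> k /=; rewrite addr0.
Qed.

Lemma holoM (R : realType) m (W : set 'rV[R[i]]_m) g g' :
  open W -> holo W g -> holo W g' -> holo W (fun a => g a * g' a).
Proof.
move=> oW h h'; apply: holoI => [k|a Wa]; first exact: (CkM oW (h.1 k) (h'.1 k)).
eexists; apply: (wdiff_eq (wdiffM (holo_wdiff oW h Wa) (holo_wdiff oW h' Wa))).
  by move=> k; reflexivity.
by move=> k /=; rewrite mulr0 mul0r addr0.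
Qed.

Lemma holoN (R : realType) m (W : set 'rV[R[i]]_m) g :
  open W -> holo W g -> holo W (fun a => - g a).
Proof.
move=> oW h; apply: (holo_ext oW (g := fun a => -1 * g a)).
  by move=> a _; rewrite mulN1r.
by apply: holoM => //; exact: holo_cst.
Qed.

Lemma holoV (R : realType) m (W : set 'rV[R[i]]_m) g :
  open W -> (forall a, W a -> g a != 0) -> holo W g -> holo W (fun a => (g a)^-1).
Proof.
move=> oW g0 h; apply: holoI => [k|a Wa]; first exact: (CkV oW g0 (h.1 k)).
eexists; apply: (wdiff_eq (wdiffV (g0 _ Wa) (holo_wdiff oW h Wa))).
  by move=> k; reflexivity.
by move=> k /=; rewrite oppr0 mul0r.
Qed.

Lemma wdiff_comp (R : realType) m p (W : set 'rV[R[i]]_m) (V : set 'rV[R[i]]_p)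
    (F : 'rV[R[i]]_m -> 'rV[R[i]]_p) g a :
  open W -> open V -> W a -> V (F a) ->
  holo_map W F -> holo V g ->
  wdiff (fun b => g (F b)) a (fun k => \sum_j dz k (fun b => F b 0 j) a * dz j g (F a))
    (fun=> 0).
Proof.
move=> oW oV Wa VFa hF hg v.
have := @cder_chain _ _ V g (fun x : R => F (a + x%:C%C *: v))
  (\row_j \sum_k (v 0 k * dz k (fun b => F b 0 j) a)) oV (hg.1 1%N).
rewrite line0 => /(_ VFa) h; apply: (cder_eqval (h _) _).
  move=> j; rewrite mxE; apply: (cder_eqval (holo_wdiff oW (hF j) Wa v) _).
  by apply: eq_bigr => k _; rewrite mulr0 addr0.
transitivity (\sum_j \sum_k v 0 k * dz k (fun b => F b 0 j) a * dz j g (F a)).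
  by apply: eq_bigr => j _; rewrite hg.2// mulr0 addr0 mxE mulr_suml.
rewrite exchange_big /=; apply: eq_bigr => k _.
by rewrite mulr0 addr0 mulr_sumr; apply: eq_bigr => j _; rewrite mulrA.
Qed.

Lemma holo_comp (R : realType) m p (W : set 'rV[R[i]]_m) (V : set 'rV[R[i]]_p)
    (F : 'rV[R[i]]_m -> 'rV[R[i]]_p) g :
  open W -> open V -> (forall a, W a -> V (F a)) ->
  holo_map W F -> holo V g -> holo W (fun a => g (F a)).
Proof.
move=> oW oV WV hF hg; apply: holoI => [k|a Wa].
  exact: (Ck_comp oW oV WV (fun j => (hF j).1 k) (hg.1 k)).
by eexists; exact: (wdiff_comp oW oV Wa (WV _ Wa) hF hg).
Qed.

(** * Symmetry of second derivatives *)

Lemma near_square (R : realType) m (A : set 'rV[R[i]]_m)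
    (a v w : 'rV[R[i]]_m) :
  nbhs a A -> \forall t \near (0 : R), forall s s' : R, `|s| <= `|t| -> `|s'| <= `|t| ->
    A (a + s%:C%C *: v + s'%:C%C *: w).
Proof.
move=> aA.
have c2 : (fun st : R * R => a + st.1%:C%C *: v + st.2%:C%C *: w) @
    (nbhs (0 : R), nbhs (0 : R)) --> a.
  have lin (h : R * R -> R) (u : 'rV[R[i]]_m) k :
      h @ (nbhs (0 : R), nbhs (0 : R)) --> (0 : R) ->
      (fun st => ((h st)%:C%C *: u) 0 k) @ (nbhs (0 : R), nbhs (0 : R)) --> (0 : R[i]).
    move=> h0; under eq_fun do rewrite mxE.
    rewrite -(mul0r (u 0 k)); apply: (@cvgM R[i]); last exact: cvg_cst.
    exact: (cvg_comp h (fun y : R => y%:C%C) h0 (@real_complex_continuous R 0)).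
  apply: rV_cvg => k.
  under eq_fun do rewrite mxE [X in X + _]mxE.
  have h1 := lin fst v k (@cvg_fst _ _ _ _ (nbhs_filter _)).
  have h2 := lin snd w k (@cvg_snd _ _ _ _ (nbhs_filter _)).
  have h3 := @cvgD _ R[i]^o _ _ _ _ _ _ _
    (@cvgD _ R[i]^o _ _ _ _ _ _ _ (@cvg_cst _ (a 0 k) _ _ _) h1) h2.
  by rewrite !addr0 in h3; exact: h3.
have [[P Q] /= [/nbhs_ballP[e /= e0 eP] /nbhs_ballP[e' /= e'0 eQ]] PQ] := c2 _ aA.
near=> t => s s' hs hs'; apply: (PQ (s, s')); split=> /=.
  apply: eP; rewrite -ball_normE /ball_ /= sub0r normrN; apply: le_lt_trans hs _.
  rewrite -[t]subr0 distrC; near: t.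
  exact: (@cvgr_dist_lt R R^o _ _ _ id 0 (@cvg_id _ _)).
apply: eQ; rewrite -ball_normE /ball_ /= sub0r normrN; apply: le_lt_trans hs' _.
rewrite -[t]subr0 distrC; near: t.
exact: (@cvgr_dist_lt R R^o _ _ _ id 0 (@cvg_id _ _)).
Unshelve. all: by end_near. Qed.

(** The mean value theorem, applied first in the direction v and then in the
   direction w. *)
Lemma second_difference (R : realType) m (A W : set 'rV[R[i]]_m)
    (F D DD : 'rV[R[i]]_m -> R)
    (v w a : 'rV[R[i]]_m) :
  open W -> W a -> nbhs a A ->
  (forall p, W p -> is_derive (0 : R) 1 (fun x : R => F (p + x%:C%C *: v)) (D p)) ->
  (forall p, W p -> is_derive (0 : R) 1 (fun x : R => D (p + x%:C%C *: w)) (DD p)) ->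
  \forall t \near (0 : R), exists2 p, A p &
    F (a + t%:C%C *: v + t%:C%C *: w) - F (a + t%:C%C *: v) -
      (F (a + t%:C%C *: w) - F a) = t ^+ 2 * DD p.
Proof.
move=> oW Wa aA dF dD.
have aWA : nbhs a (W `&` A) by apply: filterI => //; exact: open_nbhs_nbhs.
have := near_square v w aWA; apply: filterS => t ht.
pose phi (x : R) := F (a + t%:C%C *: w + x%:C%C *: v) - F (a + x%:C%C *: v).
have [|s st e1] := @MVT_sym R phi
    (fun x => D (a + t%:C%C *: w + x%:C%C *: v) - D (a + x%:C%C *: v)) t.
  move=> s st; apply: is_deriveB.
    apply: (is_derive_line dF); rewrite addrAC; exact: (ht s t st (lexx _)).1.
  have := ht s 0 st; rewrite normr0 => /(_ (normr_ge0 _))[].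
  by rewrite scale0r addr0 => + _; exact: is_derive_line.
have [|s' st' e2] := @MVT_sym R (fun x => D (a + s%:C%C *: v + x%:C%C *: w))
    (fun x => DD (a + s%:C%C *: v + x%:C%C *: w)) t.
  move=> s' st'; apply: (is_derive_line dD); exact: (ht s s' st st').1.
exists (a + s%:C%C *: v + s'%:C%C *: w); first exact: (ht s s' st st').2.
move: e1 e2; rewrite /phi !scale0r !addr0.
rewrite [a + _ *: w + t%:C%C *: v]addrAC [a + _ *: w + s%:C%C *: v]addrAC => -> ->.
by rewrite expr2; ring.
Qed.

(** The second difference in the directions v and w is symmetric in v and w. *)
Lemma mixed_derivative_sym (R : realType) m (W : set 'rV[R[i]]_m)
    (F D D' DD DD' : 'rV[R[i]]_m -> R)
    (v w a : 'rV[R[i]]_m) :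
  open W -> W a ->
  (forall p, W p -> is_derive (0 : R) 1 (fun x : R => F (p + x%:C%C *: v)) (D p)) ->
  (forall p, W p -> is_derive (0 : R) 1 (fun x : R => D (p + x%:C%C *: w)) (DD p)) ->
  (forall p, W p -> is_derive (0 : R) 1 (fun x : R => F (p + x%:C%C *: w)) (D' p)) ->
  (forall p, W p -> is_derive (0 : R) 1 (fun x : R => D' (p + x%:C%C *: v)) (DD' p)) ->
  DD x @[x --> a] --> DD a -> DD' x @[x --> a] --> DD' a -> DD a = DD' a.
Proof.
move=> oW Wa dF dD dF' dD' c c'.
apply/eqP; rewrite -subr_eq0 -normr_le0; apply/ler_addgt0Pr => e e0.
have e2 : 0 < e / 2 by rewrite divr_gt0.
have aA := @cvgr_dist_lt R R^o _ _ (nbhs_filter a) _ _ c _ e2.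
have aA' := @cvgr_dist_lt R R^o _ _ (nbhs_filter a) _ _ c' _ e2.
have near1 := second_difference oW Wa aA dF dD.
have near2 := second_difference oW Wa aA' dF' dD'.
have near12 := filterI near1 near2 (Filter := nbhs_filter (0 : R)).
have /filter_ex[t [t0 [[p pA e1] [p' pA' e2']]]] :=
  @filterI _ _ (dnbhs_filter (0 : R)) _ _ (nbhs_dnbhs_neq (0 : R)) (nbhs_dnbhs near12).
have e3 : DD p = DD' p'.
  have t20 : t ^+ 2 != 0 by rewrite expf_neq0.
  by apply: (mulfI t20); rewrite -e1 -e2' [a + _ *: w + _]addrAC; ring.
rewrite add0r.
have -> : DD a - DD' a = (DD a - DD p) - (DD' a - DD' p') by rewrite e3; ring.
apply: le_trans (ler_normB _ _) _.
by rewrite [e]splitr; apply: lerD; exact: ltW.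
Qed.

Lemma rderive_sym (R : realType) m (W : set 'rV[R[i]]_m) (g : 'rV[R[i]]_m -> R[i])
    (v w a : 'rV[R[i]]_m) :
  open W -> Ck 2 W g -> W a ->
  rderive (rderive g v) w a = rderive (rderive g w) v a.
Proof.
move=> oW hg Wa.
have h u := CkS_Ck u hg; have hh u u' := CkS_Ck u' (h u).
have d u p Wp := CkS_cder hg u Wp (a := p).
have dd u u' p Wp := CkS_cder (h u) u' Wp (a := p).
have c u u' := Ck_cont (hh u u') Wa.
apply: Complex_inj.
  exact: (@mixed_derivative_sym R m W (fun p => Re (g p)) (fun p => Re (rderive g v p))
    (fun p => Re (rderive g w p)) (fun p => Re (rderive (rderive g v) w p))
    (fun p => Re (rderive (rderive g w) v p)) v w a oW Wa
    (fun p Wp => (d v p Wp).1) (fun p Wp => (dd v w p Wp).1)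
    (fun p Wp => (d w p Wp).1) (fun p Wp => (dd w v p Wp).1)
    (Re_cvg _ (c v w)) (Re_cvg _ (c w v))).
exact: (@mixed_derivative_sym R m W (fun p => Im (g p)) (fun p => Im (rderive g v p))
  (fun p => Im (rderive g w p)) (fun p => Im (rderive (rderive g v) w p))
  (fun p => Im (rderive (rderive g w) v p)) v w a oW Wa
  (fun p Wp => (d v p Wp).2) (fun p Wp => (dd v w p Wp).2)
  (fun p Wp => (d w p Wp).2) (fun p Wp => (dd w v p Wp).2)
  (Im_cvg _ (c v w)) (Im_cvg _ (c w v))).
Qed.

Lemma holo_rderive (R : realType) m (W : set 'rV[R[i]]_m) (g : 'rV[R[i]]_m -> R[i]) a v :
  open W -> holo W g -> W a -> rderive g v a = \sum_k v 0 k * dz k g a.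
Proof.
move=> oW hg Wa; rewrite (cder_rderive (holo_wdiff oW hg Wa v)).2.
by apply: eq_bigr => k _; rewrite mulr0 addr0.
Qed.

Lemma holo_dzE (R : realType) m (W : set 'rV[R[i]]_m) (g : 'rV[R[i]]_m -> R[i]) a j :
  open W -> holo W g -> W a -> dz j g a = rderive g (delta_mx 0 j) a.
Proof.
move=> oW hg Wa; rewrite (holo_rderive _ oW hg Wa) -[delta_mx _ _]scale1r.
by rewrite sum_delta mul1r.
Qed.

(** The derivative of dz_j g along v is that of the function sum_i v_i dz_i g along
   e_j, because second derivatives commute; so it is complex linear in v. *)
Lemma holo_dz (R : realType) m (W : set 'rV[R[i]]_m) (g : 'rV[R[i]]_m -> R[i]) j :
  open W -> holo W g -> holo W (dz j g).
Proof.
move=> oW hg; have sdz i k := (Ck_dz i oW (hg.1 k.+1)).1.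
apply: holoI => [k|a Wa]; first exact: sdz.
exists (fun i => rderive (dz i g) (delta_mx 0 j) a) => v.
have := CkS_cder (sdz j 1%N) v Wa; congr cder.
transitivity (rderive (rderive g (delta_mx 0 j)) v a).
  apply: (cder_rderive (cder_line_ext oW Wa _
    (CkS_cder (CkS_Ck (delta_mx 0 j) (hg.1 2%N)) v Wa))).2.
  by move=> b Wb; rewrite (holo_dzE _ oW hg Wb).
rewrite (rderive_sym _ _ oW (hg.1 2%N) Wa).
have hs : cder (fun x : R => \sum_i v 0 i * dz i g (a + x%:C%C *: delta_mx 0 j)) 0
    (\sum_i (0 * dz i g (a + (0:R)%:C%C *: delta_mx 0 j)
       + v 0 i * rderive (dz i g) (delta_mx 0 j) a)).
  apply: cder_sum => i; apply: cderM; first exact: cder_cst.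
  exact: (CkS_cder (sdz i 1%N) _ Wa).
have e b : W b -> \sum_i v 0 i * dz i g b = rderive g v b.
  by move=> Wb; rewrite (holo_rderive _ oW hg Wb).
rewrite (cder_rderive (@cder_line_ext _ _ _ _ _ _ _ _ oW Wa e hs)).2.
by apply: eq_bigr => i _; rewrite mul0r add0r mulr0 addr0.
Qed.

(** * The form ddbar log (|w_1|^2 + ... + |w_N|^2) *)

(** Lagrange's identity turns the Cauchy-Schwarz defect of the vectors dw and w
   into a sum of squares of the 2-by-2 minors.  In this form the matrix is
   visibly positive, is unchanged when w is multiplied by a holomorphic
   function, and vanishes exactly on the directions in which w stays
   proportional to itself. *)
Definition minors_form (R : realType) m N (w : 'I_N -> R[i])
    (dw : 'I_m -> 'I_N -> R[i]) : 'M[R[i]]_m :=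
  \matrix_(j, k) ((\sum_l \sum_p (dw j l * w p - dw j p * w l) *
    conjc (dw k l * w p - dw k p * w l)) / (2 * (\sum_l sqnorm (w l))%:C%C ^+ 2)).

Lemma Lagrange_identity (R : realType) N (w a b : 'I_N -> R[i]) :
  \sum_l \sum_p (a l * w p - a p * w l) * conjc (b l * w p - b p * w l) =
  2 * ((\sum_l a l * conjc (b l)) * (\sum_l w l * conjc (w l)) -
       (\sum_l w l * conjc (b l)) * (\sum_l a l * conjc (w l))).
Proof.
have e x y (f g : 'I_N -> R[i]) : x = (\sum_l f l) * (\sum_l g l) ->
    y = \sum_l \sum_p f l * g p -> x = y.
  by move=> -> ->; rewrite big_distrlr.
have e1 : (\sum_l a l * conjc (b l)) * (\sum_l w l * conjc (w l)) =
    \sum_l \sum_p (a l * conjc (b l)) * (w p * conjc (w p)) by exact: e.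
have e1' : (\sum_l a l * conjc (b l)) * (\sum_l w l * conjc (w l)) =
    \sum_l \sum_p (a p * conjc (b p)) * (w l * conjc (w l)) by rewrite e1 exchange_big.
have e2 : (\sum_l w l * conjc (b l)) * (\sum_l a l * conjc (w l)) =
    \sum_l \sum_p (w l * conjc (b l)) * (a p * conjc (w p)) by exact: e.
have e2' : (\sum_l w l * conjc (b l)) * (\sum_l a l * conjc (w l)) =
    \sum_l \sum_p (w p * conjc (b p)) * (a l * conjc (w l)) by rewrite e2 exchange_big.
rewrite mulrBr mulr_natl mulr2n {1}e1 e1' mulr_natl mulr2n {1}e2 e2'.
rewrite -!big_split -sumrB /=; apply: eq_bigr => l _.
rewrite -!big_split -sumrB /=; apply: eq_bigr => p _.
by rewrite rmorphB !rmorphM /=; ring.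
Qed.

Lemma wdiff_ln (R : realType) m (s : 'rV[R[i]]_m -> R) a p q :
  0 < s a -> wdiff (fun b => (s b)%:C%C) a p q ->
  wdiff (fun b => (ln (s b))%:C%C) a (fun k => p k / (s a)%:C%C)
    (fun k => q k / (s a)%:C%C).
Proof.
move=> sa h v; have hv := h v; set l := \sum_k _ in hv.
have lE : l = (Re l)%:C%C by exact: (cder_uniq hv (cder_real hv.1)).
have hln : is_derive (0 : R) 1 (fun x : R => ln (s (a + x%:C%C *: v))) (Re l / s a).
  have := @cder_ln _ (fun x : R => s (a + x%:C%C *: v)) 0 (Re l).
  by rewrite line0; apply => //; exact: hv.1.
apply: (cder_eqval (cder_real hln)).
rewrite rmorphM fmorphV /= -lE /l mulr_suml; apply: eq_bigr => k _.
by rewrite mulrDl !mulrA.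
Qed.

Lemma sum_sqnormC (R : realType) (I : Type) (s : seq I) (P : pred I) (w : I -> R[i]) :
  (\sum_(l <- s | P l) sqnorm (w l))%:C%C = \sum_(l <- s | P l) w l * conjc (w l).
Proof. by rewrite rmorph_sum /=; apply: eq_bigr => l _; rewrite sqnormC. Qed.

(** For S = |w_1|^2 + ... + |w_N|^2 with holomorphic w_l, the matrix of ddbar log S
   is (S ddbar S - dS dbar S) / S^2, whose numerator is given by Lagrange's
   identity. *)
Lemma ddbar_ln_sum (R : realType) m N (W : set 'rV[R[i]]_m)
    (w : 'I_N -> 'rV[R[i]]_m -> R[i]) a :
  open W -> W a -> (forall l, holo W (w l)) ->
  (forall b, W b -> 0 < \sum_l sqnorm (w l b)) ->
  ddbar (fun b => ln (\sum_l sqnorm (w l b))) a =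
  minors_form (w^~ a) (fun j l => dz j (w l) a).
Proof.
move=> oW Wa hw pos; apply/matrixP => j k; rewrite !mxE.
pose S b : R[i] := (\sum_l sqnorm (w l b))%:C%C.
have SE b : S b = \sum_l w l b * conjc (w l b) by rewrite /S sum_sqnormC.
have S0 b : W b -> S b != 0.
  by move=> /pos; rewrite lt0r => /andP[s0 _]; rewrite /S fmorph_eq0.
have dw l b : W b -> wdiff (w l) b (fun i => dz i (w l) b) (fun=> 0).
  exact: (holo_wdiff oW (hw l)).
have dS b : W b -> wdiff S b (fun i => \sum_l dz i (w l) b * conjc (w l b))
    (fun i => \sum_l w l b * conjc (dz i (w l) b)).
  move=> Wb; rewrite (_ : S = fun b => \sum_l w l b * conjc (w l b)); last exact/funext.
  have := @wdiff_sum _ _ _ (index_enum _) xpredT _ _ _ _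
    (fun l _ => wdiffM (dw l b Wb) (wdiff_conj (dw l b Wb))).
  move=> /wdiff_eq; apply => i;
  by apply: eq_bigr => l _; rewrite ?conjc0 ?mulr0 ?mul0r ?addr0 ?add0r.
have e b : W b -> (\sum_l w l b * conjc (dz k (w l) b)) * (S b)^-1 =
    dzbar k (fun b => (ln (\sum_l sqnorm (w l b)))%:C%C) b.
  by move=> Wb; have [_ ->] := wdiff_dz k (wdiff_ln (pos b Wb) (dS b Wb)).
have ddw l : wdiff (dz k (w l)) a (fun i => dz i (dz k (w l)) a) (fun=> 0).
  exact: (holo_wdiff oW (holo_dz k oW (hw l)) Wa).
have dB := @wdiff_sum _ _ _ (index_enum _) xpredT _ _ _ _
  (fun l _ => wdiffM (dw l a Wa) (wdiff_conj (ddw l))).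
have := wdiff_ext oW Wa e (wdiffM dB (wdiffV (S0 _ Wa) (dS _ Wa))).
move=> /(wdiff_dz j)[-> _].
rewrite Lagrange_identity -!SE.
rewrite (eq_bigr (fun l => dz j (w l) a * conjc (dz k (w l) a))); last first.
  by move=> l _; rewrite conjc0 mulr0 addr0.
have := S0 _ Wa; rewrite /S; move: (_%:C%C) => s s0.
have two0 : (2 : R[i]) != 0 by rewrite pnatr_eq0.
move: (\sum_l _) (\sum_l _) (\sum_l _) => A B C; field; rewrite ?s0 ?two0 //.
Qed.

(** The differential of c w_l is dc w_l + c dw_l, and the part proportional to w
   does not contribute to the minors. *)
Lemma minors_form_scale (R : realType) m N (w : 'I_N -> R[i])
    (dw : 'I_m -> 'I_N -> R[i]) (c : R[i]) (dc : 'I_m -> R[i]) :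
  c != 0 ->
  minors_form (fun l => c * w l) (fun j l => dc j * w l + c * dw j l) =
  minors_form w dw.
Proof.
move=> c0; apply/matrixP => j k; rewrite !mxE.
have -> : \sum_l sqnorm (c * w l) = sqnorm c * \sum_l sqnorm (w l).
  by rewrite mulr_sumr; apply: eq_bigr => l _; rewrite sqnormM.
have -> : \sum_l \sum_p
    ((dc j * w l + c * dw j l) * (c * w p) - (dc j * w p + c * dw j p) * (c * w l)) *
    conjc ((dc k * w l + c * dw k l) * (c * w p) -
      (dc k * w p + c * dw k p) * (c * w l)) =
    (sqnorm c)%:C%C ^+ 2 * \sum_l \sum_p (dw j l * w p - dw j p * w l) *
    conjc (dw k l * w p - dw k p * w l).
  rewrite mulr_sumr; apply: eq_bigr => l _; rewrite mulr_sumr; apply: eq_bigr => p _.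
  by rewrite sqnormC !(rmorphB, rmorphM, rmorphD) /=; ring.
have c1 : (sqnorm c)%:C%C ^+ 2 != 0 by rewrite expf_neq0// fmorph_eq0 sqnorm_eq0.
rewrite rmorphM /= exprMn.
by rewrite mulrCA -mulf_div divff// mul1r.
Qed.

Lemma minors_form_pullback (R : realType) m p N (J : 'M[R[i]]_(m, p))
    (w : 'I_N -> R[i]) (dw : 'I_p -> 'I_N -> R[i]) :
  J *m minors_form w dw *m adjmx J =
  minors_form w (fun j l => \sum_i J j i * dw i l).
Proof.
apply/matrixP => j k; rewrite !mxE.
have lin j' l q : (\sum_i J j' i * dw i l) * w q - (\sum_i J j' i * dw i q) * w l =
    \sum_i J j' i * (dw i l * w q - dw i q * w l).
  rewrite !mulr_suml -sumrB; apply: eq_bigr => i _; ring.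
under [in RHS]eq_bigr do under eq_bigr do rewrite !lin rmorph_sum big_distrlr /=.
under [LHS]eq_bigr do rewrite !mxE mulr_suml.
set S := 2 * _.
transitivity (\sum_i \sum_i' \sum_l \sum_q J j i * conjc (J k i') *
   ((dw i l * w q - dw i q * w l) * conjc (dw i' l * w q - dw i' q * w l)) / S).
  rewrite exchange_big; apply: eq_bigr => i _; apply: eq_bigr => i' _.
  rewrite !mxE -/S.
  rewrite mulrAC mulrA !mulr_sumr.
  rewrite mulr_suml; apply: eq_bigr => l _.
  rewrite !mulr_sumr !mulr_suml; apply: eq_bigr => q _.
  by [].
transitivity (\sum_l \sum_q \sum_i \sum_i' J j i * conjc (J k i') *
   ((dw i l * w q - dw i q * w l) * conjc (dw i' l * w q - dw i' q * w l)) / S).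
  rewrite [RHS](eq_bigr (fun l => \sum_i \sum_i' \sum_q J j i * conjc (J k i') *
    ((dw i l * w q - dw i q * w l) *
     conjc (dw i' l * w q - dw i' q * w l)) / S)); last first.
    move=> l _; rewrite exchange_big; apply: eq_bigr => i _; exact: exchange_big.
  rewrite [RHS]exchange_big; apply: eq_bigr => i _; exact: exchange_big.
rewrite mulr_suml; apply: eq_bigr => l _; rewrite mulr_suml; apply: eq_bigr => q _.
rewrite mulr_suml; apply: eq_bigr => i _; rewrite mulr_suml; apply: eq_bigr => i' _.
by rewrite rmorphM /=; ring.
Qed.

(** The factor 1 / 4 pi is 1 / 2 pi from the Chern form times 1 / 2 from
   Lagrange's identity. *)
Lemma herm_minors_form (R : realType) m N (w : 'I_N -> R[i])
    (dw : 'I_m -> 'I_N -> R[i]) (v : 'rV[R[i]]_m) :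
  let A l := \sum_j v 0 j * dw j l in
  herm_of_form ((- ('i%C / (2 * pi)%:C%C)) *: minors_form w dw) v =
  (- ((\sum_l \sum_p sqnorm (A l * w p - A p * w l)) /
      (4 * pi * (\sum_l sqnorm (w l)) ^+ 2)))%:C%C.
Proof.
move=> A; rewrite /herm_of_form scalerA -scalemxAr -scalemxAl minors_form_pullback.
rewrite !mxE.
have -> : - 'i%C * - ('i%C / (2 * pi)%:C%C) = - ((2 * pi)^-1)%:C%C :> R[i].
  by rewrite mulrNN mulrA -expr2 sqr_i mulN1r fmorphV.
rewrite [in X in _ * (X / _)](eq_bigr (fun l =>
  (\sum_p sqnorm (A l * w p - A p * w l))%:C%C)); last first.
  move=> l _; rewrite rmorph_sum /=; apply: eq_bigr => p _.
  by rewrite sqnormC.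
rewrite -rmorph_sum /= mulNr rmorphN /=; congr (- _).
have two x : 2 * x%:C%C ^+ 2 = (2 * x ^+ 2)%:C%C :> R[i].
  by rewrite rmorphM rmorphXn rmorph_nat.
rewrite two -fmorphV -!rmorphM /=.
congr (_%:C%C).
rewrite !invfM; have : (4 : R)^-1 = 2^-1 * 2^-1 by rewrite -invfM; congr (_^-1); ring.
by move=> ->; ring.
Qed.

(** * The identity theorem *)

(** Were l positive, the derivative df would be positive on a right neighbourhood
   of its zero 0, and f would increase there. *)
Lemma second_derivative_le0 (R : realType) (f df : R -> R) (l : R) :
  (\forall x \near (0 : R), is_derive (x : R) 1 f (df x)) ->
  is_derive (0 : R) 1 df l -> (\forall x \near (0 : R), f x <= f 0) -> l <= 0.
Proof.
move=> hf [hdf hl] hmax; rewrite leNgt; apply/negP => l0.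
have [e /= e0 he] : nbhs_ball (0 : R)
    [set x : R | is_derive (x : R) 1 f (df x) /\ f x <= f 0].
  by apply/nbhs_ballP; exact: filterI.
have ballE (x d : R) : ball (0 : R) d x = (`|x| < d) :> Prop.
  by rewrite -ball_normE /ball_ /= sub0r normrN.
have inb x : x \in `]-e, e[ -> ball (0 : R) e x.
  by rewrite in_itv /= ballE ltr_norml.
have zin : 0 \in `]-e, e[ by rewrite in_itv /= oppr_lt0 e0.
have d0 : df 0 = 0.
  have [_ h1] : is_derive (0 : R) 1 f 0.
    have le_ee : - e <= e by rewrite (le_trans _ (ltW e0))// oppr_le0 ltW.
    have df1 t : t \in `]-e, e[ -> derivable f t 1 by move=> /inb/he[[]].
    have fmax t : t \in `]-e, e[ -> f t <= f 0 by move=> /inb/he[].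
    exact (derive1_at_max le_ee df1 zin fmax).
  by have [[_ <-] _] := he _ (inb _ zin); rewrite h1.
have hq : (fun h : R => h^-1 *: ((df \o shift 0) (h *: 1) - df 0)) @ (0 : R)^' --> l.
  by rewrite -hl; exact: hdf.
have [d /= dpos hd] : nbhs_ball (0 : R) [set h : R | h != 0 -> 0 < h^-1 * df h].
  apply/nbhs_ballP.
  have h1 : nbhs (0 : R)
      [set h : R | h != 0 -> 0 < h^-1 *: ((df \o shift 0) (h *: 1) - df 0)].
    exact: (@cvgr_gt _ _ _ _ _ _ hq 0 l0).
  apply: filterS h1 => h /= hh /hh.
  by rewrite addr0 [h *: 1]mulr1 d0 subr0.
pose x := Num.min (d / 2) (e / 2).
have x0 : 0 < x by rewrite lt_min !divr_gt0.
have half (y : R) : 0 < y -> y / 2 < y by move=> y0; lra.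
have xe : x < e by rewrite gt_min (half e e0) orbT.
have xd : x < d by rewrite gt_min (half d dpos).
have hder (y : R) : `|y| <= `|x| -> is_derive y 1 f (df y).
  move=> yx; apply: (he y _).1; rewrite ballE (le_lt_trans yx)//.
  by rewrite ger0_norm// ltW.
have [||c cx ec] := @MVT _ f df 0 x x0.
- move=> y; rewrite in_itv /= => /andP[y0 yx]; apply: hder.
  by rewrite !ger0_norm// ltW.
- apply: continuous_in_subspaceT => y; rewrite inE /= in_itv /= => /andP[y0 yx].
  by apply: (is_derive_cont (hder y _)); rewrite !ger0_norm// ltW.
- move: cx; rewrite in_itv /= => /andP[c0 cx].
  have := hd c; rewrite /= ballE ger0_norm ?(ltW c0)// => /(_ (lt_trans cx xd)).
  rewrite gt_eqF// => /(_ isT); rewrite pmulr_rgt0 ?invr_gt0// => dc.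
  have : 0 < f x - f 0 by rewrite ec subr0 mulr_gt0.
  rewrite subr_gt0 ltNge => /negP; apply.
  by apply: (he x _).2; rewrite ballE ger0_norm// ltW.
Qed.

(** The second derivatives of u along e_j and along i e_j have the sum
   4 (|dz_j H|^2 + eps), so they are not both nonpositive. *)
Lemma strict_subharmonic_no_max (R : realType) m (W : set 'rV[R[i]]_m)
    (H : 'rV[R[i]]_m -> R[i]) (a : 'rV[R[i]]_m) (j : 'I_m) (eps : R) :
  open W -> W a -> holo W H -> 0 < eps ->
  let u b := sqnorm (H b) + eps * sqnorm (b 0 j) in
  ~ (forall v, \forall x \near (0 : R), u (a + x%:C%C *: v) <= u a).
Proof.
move=> oW Wa hH eps0 u umax.
have jj : (j == j)%:R = 1 :> R[i] by rewrite eqxx.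
pose P b := dz j H b * conjc (H b) + eps%:C%C * conjc (b 0 j).
pose U b := (u b)%:C%C : R[i].
have dU b z : W b -> cder (fun x : R => U (b + x%:C%C *: (z *: delta_mx 0 j))) 0
    (z * P b + conjc (z * P b)).
  move=> Wb; have dH := holo_wdiff oW hH Wb.
  have dUb := wdiffD (wdiffM dH (wdiff_conj dH)) (wdiffM (wdiff_cst eps%:C%C b)
     (wdiffM (wdiff_coord j b) (wdiff_conj (wdiff_coord j b)))).
  have -> : U = fun b => H b * conjc (H b) + eps%:C%C * (b 0 j * conjc (b 0 j)).
    by apply/funext => c; rewrite /U /u rmorphD rmorphM /= !sqnormC.
  apply: (cder_eqval (dUb _)); rewrite sum_delta_wdiff.
  rewrite /P; have := conjc_real eps.
  move: (dz j H b) (H b) eps%:C%C (b 0 j) => h y e c ee.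
  by rewrite !conjcM !conjcD !conjcM !conjcK jj conjc0 conjc1 ee; ring.
pose q : R := sqnorm (dz j H a) + eps.
pose p := dz j (dz j H) a * conjc (H a).
have dP z : cder (fun x : R => P (a + x%:C%C *: (z *: delta_mx 0 j))) 0
    (z * p + conjc z * q%:C%C).
  have dH := holo_wdiff oW hH Wa; have ddH := holo_wdiff oW (holo_dz j oW hH) Wa.
  have dPa := wdiffD (wdiffM ddH (wdiff_conj dH)) (wdiffM (wdiff_cst eps%:C%C a)
     (wdiff_conj (wdiff_coord j a))).
  apply: (cder_eqval (dPa _)); rewrite sum_delta_wdiff.
  have qE : q%:C%C = dz j H a * conjc (dz j H a) + eps%:C%C.
    by rewrite /q rmorphD /= sqnormC.
  rewrite /p qE jj conjc0 conjc1.
  by move: (dz j (dz j H) a) (dz j H a) (H a) eps%:C%C (a 0 j) => p' h y e c; ring.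
(* Half of the second derivative of u along z e_j. *)
have second z : Re (z * (z * p + conjc z * q%:C%C)) <= 0.
  set v : 'rV_m := z *: delta_mx 0 j.
  have du b : W b ->
      is_derive (0 : R) 1 (fun x : R => u (b + x%:C%C *: v)) (2 * Re (z * P b)).
    move=> Wb; rewrite mulr_natl mulr2n -{2}Re_conj -ReD.
    exact: (dU b z Wb).1.
  have dd : is_derive (0 : R) 1 (fun x : R => 2 * Re (z * P (a + x%:C%C *: v)))
      (2 * Re (z * (z * p + conjc z * q%:C%C))).
    have h1 := (cderM (cder_cst z 0) (dP z)).1.
    rewrite mul0r add0r in h1.
    have := is_deriveZ 2 h1; exact.
  rewrite -(pmulr_rle0 _ (ltr0Sn R 1)).
  apply: (second_derivative_le0 (f := fun x : R => u (a + x%:C%C *: v)) _ dd).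
    apply: filterS (open_line v oW Wa) => x Wx.
    exact: (is_derive_line (D := fun b => 2 * Re (z * P b)) du Wx).
  by apply: filterS (umax v) => x; rewrite line0.
have := second 1; have := second 'i%C.
have -> : 'i%C * ('i%C * p + conjc 'i%C * q%:C%C) = - p + q%:C%C.
  by case: (p) => x y; apply: Complex_inj => /=; ring.
rewrite conjc1 !mul1r !ReD ReN /= => h1 h2.
have : q <= 0 by lra.
by rewrite leNgt /q ltr_wpDl ?sqnorm_ge0.
Qed.

(** The bounds are on the squared modulus. *)
Definition annulus (R : realType) (r s : R) : set 'rV[R[i]]_1 :=
  [set z | r <= sqnorm (z 0 0) <= s].

(** The annulus is the image of a compact subset of R^2. *)
Lemma annulus_max (R : realType) (r s : R) (u : 'rV[R[i]]_1 -> R) :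
  annulus r s !=set0 ->
  (forall z, annulus r s z -> u x @[x --> z] --> u z) ->
  exists2 c, annulus r s c & forall z, annulus r s z -> u z <= u c.
Proof.
move=> [z0 z0K] cu.
pose emb (t : 'rV[R]_2) : 'rV[R[i]]_1 := const_mx (Complex (t 0 0) (t 0 1)).
pose q (t : 'rV[R]_2) : R := t 0 0 ^+ 2 + t 0 1 ^+ 2.
have qE t : sqnorm (emb t 0 0) = q t by rewrite mxE.
have embE (z : 'rV[R[i]]_1) :
    emb (\row_i if i == 0 then Re (z 0 0) else Im (z 0 0)) = z.
  by apply/rowP => i; rewrite !mxE /= !ord1; apply: Complex_inj.
have ct (i : 'I_2) (t : 'rV[R]_2) : (fun y : 'rV[R]_2 => y 0 i) y @[y --> t] --> t 0 i.
  exact: (@rV_coord_cvg R _ _ (nbhs_filter t) _ id t i (@cvg_id _ _)).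
have cemb t : emb x @[x --> t] --> emb t.
  apply: rV_cvg => k; under eq_fun do rewrite mxE.
  by rewrite mxE; apply: Complex_cvg; exact: ct.
pose K := [set t | r <= q t <= s].
have cq : continuous q.
  by move=> t; exact: (@cvgD R R^o _ _ _ _ _ _ _ (@cvgM R _ _ _ _ _ _ _ (ct 0 t) (ct 0 t))
      (@cvgM R _ _ _ _ _ _ _ (ct 1 t) (ct 1 t))).
have Kcl : closed K.
  rewrite (_ : K = q @^-1` `[r, s]%classic); last first.
    by apply/seteqP; split=> t; rewrite /K /= in_itv.
  apply: preimage_closed; last exact: itv_closed.
  move=> t _. exact: cq.
have Kco : compact K.
  apply: (subclosed_compact Kcl
    (@rV_compact R 2 (fun=> `[- (s + 1), s + 1]%classic) (fun=> @segment_compact R _ _))).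
  move=> t; rewrite /K /= /q => /andP[_ ts] i; rewrite /= in_itv /= -ler_norml.
  have ti : t 0 i ^+ 2 <= s.
    apply: le_trans ts; case: i => -[|[|//]] h.
      by rewrite (_ : Ordinal h = 0) ?lerDl ?sqr_ge0//; exact: val_inj.
    by rewrite (_ : Ordinal h = 1) ?lerDr ?sqr_ge0//; exact: val_inj.
  have s0 : 0 <= s by exact: le_trans (sqr_ge0 _) ti.
  rewrite -(@ler_pXn2r _ 2)// ?nnegrE ?addr_ge0// real_normK ?num_real//.
  by apply: le_trans ti _; nra.
have [|||c cK cmax] := @EVT_max_rV R _ (u \o emb) K.
- exists (\row_i if i == 0 then Re (z0 0 0) else Im (z0 0 0)).
  by rewrite /K /= -qE embE.
- exact: Kco.
- apply: continuous_in_subspaceT => t; rewrite inE => tK.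
  apply: (cvg_comp emb u (cemb t)); apply: cu.
  by rewrite /annulus /= qE.
exists (emb c); first by move: cK; rewrite inE /annulus /= qE.
move=> z zK; rewrite -(embE z); apply: (cmax (\row_i _)); rewrite inE /K /= -qE embE.
exact: zK.
Qed.

Lemma holoX (R : realType) m (W : set 'rV[R[i]]_m) g k :
  open W -> holo W g -> holo W (fun a => g a ^+ k).
Proof.
move=> oW hg; elim: k => [|k ih]; first exact: holo_cst.
apply: (holo_ext oW (g := fun a => g a * g a ^+ k)) => [a _|].
  by rewrite exprS.
exact: holoM.
Qed.

Lemma sqnormX (R : realType) (z : R[i]) k : sqnorm (z ^+ k) = sqnorm z ^+ k.
Proof. by elim: k => [|k ih]; rewrite ?sqnorm1// !exprS sqnormM ih. Qed.

(** The maximum principle for g / z^k, which vanishes on the inner circle, bounds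
   |g|^2 by M (|z|^2 / s)^k, where M is the maximum of |g|^2.  The bound tends
   to 0 as k grows. *)
Lemma annulus_vanish (R : realType) (r s : R) (W : set 'rV[R[i]]_1)
    (g : 'rV[R[i]]_1 -> R[i]) :
  0 < r -> open W -> holo W g -> annulus r s `<=` W ->
  (forall z : 'rV[R[i]]_1, sqnorm (z 0 0) = r -> g z = 0) ->
  forall z : 'rV[R[i]]_1, annulus r s z -> sqnorm (z 0 0) < s -> g z = 0.
Proof.
move=> r0 oW hg KW gr z zK zs.
have s0 : 0 < s by exact: le_lt_trans (sqnorm_ge0 _) zs.
have [c cK cmax] := annulus_max (ex_intro _ z zK)
  (fun y yK => sqnorm_cvg _ (holo_cont hg (KW y yK))).
set M := sqnorm (g c) in cmax.
have bound k : sqnorm (g z) <= M * (sqnorm (z 0 0) / s) ^+ k.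
  pose W' := W `&` [set y | y 0 0 != 0].
  have ne0 y : annulus r s y -> y 0 0 != 0.
    by move=> /andP[ry _]; rewrite -sqnorm_eq0 gt_eqF// (lt_le_trans r0).
  have oW' : open W'.
    by apply: open_neq0 => // y _; apply: rV_coord_cvg; exact: cvg_id.
  have KW' : annulus r s `<=` W' by move=> y yK; split; [exact: KW|exact: ne0].
  pose H y := g y * ((y 0 0)^-1) ^+ k.
  have hH : holo W' H.
    apply: holoM => //; first by apply: (holo_sub _ hg) => y [].
    apply: holoX => //; apply: holoV => //; first by move=> y [].
    exact: holo_coord.
  have HE y : sqnorm (H y) = sqnorm (g y) / sqnorm (y 0 0) ^+ k.
    by rewrite /H sqnormM sqnormX sqnormV exprVn.
  (* Adding eps |z|^2 makes |H|^2 strictly subharmonic, hence maximal on one of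
     the two circles only. *)
  have main eps : 0 < eps -> sqnorm (H z) <= M / s ^+ k + eps * s.
    move=> eps0; pose u y := sqnorm (H y) + eps * sqnorm (y 0 0).
    have [|d dK dmax] := @annulus_max R r s u (ex_intro _ z zK).
      move=> y yK; apply: (@cvgD R R^o).
        exact: (sqnorm_cvg _ (holo_cont hH (KW' y yK))).
      apply: (@cvgM R); first exact: cvg_cst.
      by apply: sqnorm_cvg; apply: rV_coord_cvg; exact: cvg_id.
    have M0 : 0 <= M / s ^+ k by rewrite divr_ge0 ?sqnorm_ge0// exprn_ge0// ltW.
    apply: (@le_trans _ _ (u z)); first by rewrite lerDl mulr_ge0 ?sqnorm_ge0// ltW.
    apply: le_trans (dmax z zK) _.
    have /andP[rd ds] := dK.
    have [dr|dr] := eqVneq (sqnorm (d 0 0)) r.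
      rewrite /u HE gr// (eqP (_ : sqnorm 0 == 0)) ?sqnorm_eq0// mul0r add0r.
      by rewrite (le_trans _ (_ : eps * s <= _)) ?lerDr// ler_wpM2l// ltW.
    have [ds'|ds'] := eqVneq (sqnorm (d 0 0)) s.
      by rewrite /u HE ds' lerD2r ler_pM2r ?invr_gt0 ?exprn_gt0//; exact: cmax.
    exfalso; apply: (strict_subharmonic_no_max oW' (KW' d dK) hH eps0 (j := 0)) => v.
    have oA : open [set y : 'rV[R[i]]_1 | r < sqnorm (y 0 0) < s].
      have -> : [set y : 'rV[R[i]]_1 | r < sqnorm (y 0 0) < s] =
          setT `&` (fun y : 'rV[R[i]]_1 => sqnorm (y 0 0)) @^-1` `]r, s[%classic.
        by apply/seteqP; split=> y /=; rewrite in_itv /= => // -[].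
      apply: open_preim; [exact: openT|exact: interval_open|move=> y _].
      by apply: sqnorm_cvg; apply: rV_coord_cvg; exact: cvg_id.
    have dA : r < sqnorm (d 0 0) < s by rewrite !lt_neqAle eq_sym dr rd ds' ds.
    apply: filterS (open_line v oA dA) => x /andP[rx xs].
    by apply: dmax; rewrite /annulus /= !ltW.
  have : sqnorm (H z) <= M / s ^+ k.
    apply/ler_addgt0Pr => e e0; have := main (e / s); rewrite divfK ?gt_eqF//.
    by apply; rewrite divr_gt0.
  have zk0 : 0 < sqnorm (z 0 0) ^+ k.
    by rewrite exprn_gt0// (lt_le_trans r0)//; case/andP: zK.
  by rewrite HE ler_pdivrMr// expr_div_n mulrA -[M / _ * _]mulrAC.
apply/eqP; rewrite -sqnorm_eq0 eq_le sqnorm_ge0 andbT.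
set t := sqnorm (z 0 0) / s in bound.
have t1 : `|t| < 1.
  rewrite ger0_norm ?divr_ge0 ?sqnorm_ge0 ?ltW//.
  by rewrite ltr_pdivrMr// mul1r.
have lim0 : M * t ^+ k @[k --> \oo] --> (0 : R).
  rewrite -(mulr0 M); apply: (@cvgM R); [exact: cvg_cst|exact: cvg_expr].
apply: (@cvgr_to_ge _ _ _ R _ _ _ lim0).
by near=> k; exact: bound.
Unshelve. all: by end_near. Qed.

Lemma holo_map_line (R : realType) m (W : set 'rV[R[i]]_1) (a v : 'rV[R[i]]_m) :
  open W -> holo_map W (fun z => a + z 0 0 *: v).
Proof.
move=> oW k; apply: (holo_ext oW (g := fun z => a 0 k + z 0 0 * v 0 k)).
  by move=> z _; rewrite !mxE.
apply: holoD => //; first exact: holo_cst.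
by apply: holoM => //; [exact: holo_coord|exact: holo_cst].
Qed.

Lemma holo_map_cont (R : realType) m p (W : set 'rV[R[i]]_m)
    (F : 'rV[R[i]]_m -> 'rV[R[i]]_p) a :
  holo_map W F -> W a -> F x @[x --> a] --> F a.
Proof. by move=> hF Wa; apply: rV_cvg => k; exact: (holo_cont (hF k) Wa). Qed.

Lemma line_vanish (R : realType) m (W : set 'rV[R[i]]_m) g (a v : 'rV[R[i]]_m)
    (r s : R) :
  0 < r -> open W -> holo W g ->
  (forall z, sqnorm z <= s -> W (a + z *: v)) ->
  (forall z, sqnorm z <= r -> g (a + z *: v) = 0) ->
  forall z, sqnorm z < s -> g (a + z *: v) = 0.
Proof.
move=> r0 oW hg inW g0 z zs; have [zr|zr] := leP (sqnorm z) r; first exact: g0.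
pose F (y : 'rV[R[i]]_1) := a + y 0 0 *: v.
have hFT := holo_map_line a v (@openT 'rV[R[i]]_1).
have oW1 : open (setT `&` F @^-1` W).
  by apply: open_preim => // [|y _]; [exact: openT|exact: holo_map_cont hFT _].
have hF : holo_map (setT `&` F @^-1` W) F by exact: holo_map_line.
have hgF : holo (setT `&` F @^-1` W) (fun y => g (F y)).
  by apply: (holo_comp oW1 oW _ hF hg) => y [].
have := @annulus_vanish R r s _ _ r0 oW1 hgF _ _ (const_mx z).
rewrite /F mxE; apply => //.
- by move=> y /andP[_ ys]; split => //; exact: inW.
- by move=> y yr; apply: g0; rewrite yr.
- by rewrite /annulus /= mxE !ltW.
Qed.

(** N is a ball so small that the complex line from b through c, for b and c in N,
   stays in D up to the parameter 2, whereas c has the parameter 1. *)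
Lemma local_identity (R : realType) m (D : set 'rV[R[i]]_m) t :
  open D -> D t -> exists N, [/\ nbhs t N, N `<=` D &
    forall g, holo D g -> forall b, N b -> nbhs b [set c | g c = 0] ->
      forall c, N c -> g c = 0].
Proof.
move=> oD Dt.
have /nbhs_ballP[e /= e0 eD] : nbhs t D by exact: open_nbhs_nbhs.
have e5 : 0 < e / 5 by rewrite divr_gt0// ltr0n.
exists (ball t (e / 5)); split.
- by apply/nbhs_ballP; exists (e / 5).
- apply: subset_trans eD; apply: le_ball.
  by rewrite ler_pdivrMr ?ltr0n// ler_peMr ?ler1n// ltW.
move=> g hg b bN gb0 c cN.
have zero_near : exists2 r, 0 < r & forall z, sqnorm z <= r -> g (b + z *: (c - b)) = 0.
  have cont : (fun y : 'rV[R[i]]_1 => b + y 0 0 *: (c - b)) @ (0 : 'rV[R[i]]_1) --> b.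
    have := holo_map_cont (holo_map_line b (c - b) (@openT 'rV[R[i]]_1)) (I : setT 0).
    by rewrite mxE scale0r addr0.
  have /nbhs_ballP[d /= /gt0_complexE[d' d0 ->] hd] := cont _ gb0.
  exists ((d' / 2) ^+ 2); first by rewrite exprn_gt0// divr_gt0.
  move=> z zd; have := hd (const_mx z); rewrite /= mxE; apply.
  split => [|i j]; first by rewrite ltcR.
  rewrite !mxE -ball_normE /ball_ /= sub0r normrN ltr_sqnorm//.
  apply: le_lt_trans zd _; rewrite ltr_pXn2r ?nnegrE ?divr_ge0 ?ltW//.
  by rewrite ltr_pdivrMr// ltr_pMr// ltr1n.
have [r r0 hr] := zero_near.
have := @line_vanish R m D g b (c - b) r 4 r0 oD hg _ hr 1.
rewrite scale1r subrKC; apply; last by rewrite sqnorm1 ltr1n.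
move=> z z4; apply: eD; move: bN cN; rewrite -!ball_normE /ball_ /= => bN cN.
have z2 : `|z| <= 2.
  rewrite -(@ler_pXn2r _ 2)// ?nnegrE ?ler0n// sqnorm_normr -natrX.
  by rewrite -(rmorph_nat (real_complex R)) lecR.
have cb : `|c - b| <= e / 5 + e / 5.
  rewrite (_ : c - b = (t - b) - (t - c)); last by rewrite opprB [RHS]addrC addrA subrK.
  by apply: le_trans (ler_normB _ _) _; apply: lerD; exact: ltW.
rewrite opprD addrA; apply: le_lt_trans (ler_normB _ _) _; rewrite normrZ.
have -> : e = e / 5 + 2 * (e / 5 + e / 5).
  have five0 : (5 : R[i]) != 0 by rewrite pnatr_eq0.
  by rewrite -{1}(divfK five0 e); move: (e / 5) => x; ring.
apply: ltr_leD => //; apply: ler_pM => //.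
Qed.

(** * Homogeneous coordinates and charts *)

Lemma hcoord_neq0 (R : realType) r (p : proj_space R r) : hcoord p != 0.
Proof. exact: (valP (repr p)). Qed.

Lemma hcoord_proj (R : realType) r (v : 'rV[R[i]]_r) (nv : v != 0) :
  exists2 c, c != 0 & hcoord (proj_point nv) = c *: v.
Proof.
have : (repr (proj_point nv) = exist _ v nv %[mod proj_space R r])%qT by rewrite reprK.
move=> /eqmodP/asboolP[c e].
have {}e : hcoord (proj_point nv) = c *: v by exact: e.
exists c => //.
by apply: contra_neq (hcoord_neq0 (proj_point nv)) => c0; rewrite e c0 scale0r.
Qed.

Lemma proj_point_eq (R : realType) r (v w : 'rV[R[i]]_r) (nv : v != 0) (nw : w != 0) c :
  v = c *: w -> proj_point nv = proj_point nw.
Proof. by move=> e; apply/eqmodP/asboolP; exists c. Qed.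

Lemma proj_hcoord (R : realType) r (p : proj_space R r) :
  proj_point (hcoord_neq0 p) = p.
Proof.
rewrite -[RHS]reprK; rewrite /proj_point; congr (\pi_(_) _)%qT.
exact: val_inj.
Qed.

(** Homogeneous coordinates are determined up to a factor, so their ratios do not
   depend on the representative that hcoord picks. *)
Lemma hratio_proj (R : realType) r (v : 'rV[R[i]]_r) (nv : v != 0) k l :
  hcoord (proj_point nv) 0 k / hcoord (proj_point nv) 0 l = v 0 k / v 0 l.
Proof.
have [c c0 ->] := hcoord_proj nv.
by rewrite !mxE -mulf_div divff// mul1r.
Qed.

Lemma hcoord_proj_neq0 (R : realType) r (v : 'rV[R[i]]_r) (nv : v != 0) k :
  (hcoord (proj_point nv) 0 k != 0) = (v 0 k != 0).
Proof.
have [c c0 ->] := hcoord_proj nv.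
by rewrite mxE mulf_eq0 (negbTE c0).
Qed.

Lemma hcoord_ex (R : realType) r (p : proj_space R r) : exists i, hcoord p 0 i != 0.
Proof.
apply: contrapT => h; have /eqP := hcoord_neq0 p; apply.
apply/rowP => i; rewrite mxE; apply/eqP; apply: contrapT => /negP hi.
by apply: h; exists i.
Qed.

Lemma affine_rowE (R : realType) r (i : 'I_r) (w : 'rV[R[i]]_r.-1) k :
  affine_row i w 0 k = if unlift i k is Some k' then w 0 k' else 1.
Proof. by rewrite mxE. Qed.

Lemma affine_row_id (R : realType) r (i : 'I_r) (w : 'rV[R[i]]_r.-1) :
  affine_row i w 0 i = 1.
Proof. by rewrite mxE unlift_none. Qed.

(** The inverse of the i-th chart on the points with xi_i != 0. *)
Definition chart_coord (R : realType) n r (i : 'I_r)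
    (p : 'rV[R[i]]_n * proj_space R r) : 'rV[R[i]]_(n + r.-1) :=
  row_mx p.1 (\row_k (hcoord p.2 0 (lift i k) / hcoord p.2 0 i)).

Lemma chart_coordK (R : realType) n r (i : 'I_r) (p : 'rV[R[i]]_n * proj_space R r) :
  hcoord p.2 0 i != 0 -> chart i (chart_coord i p) = p.
Proof.
case: p => z q /= qi; rewrite /chart /chart_coord row_mxKl /=; congr (_, _).
rewrite -[RHS]proj_hcoord; apply: (@proj_point_eq _ _ _ _ _ _ (hcoord q 0 i)^-1).
apply/rowP => k; rewrite row_mxKr affine_rowE mxE.
case: unliftP => [k' ->|->]; first by rewrite mxE mulrC.
by rewrite mulVf.
Qed.

Lemma chart_hcoord_neq0 (R : realType) n r (i : 'I_r) (x : 'rV[R[i]]_(n + r.-1)) k :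
  (hcoord (chart i x).2 0 k != 0) = (affine_row i (rsubmx x) 0 k != 0).
Proof. exact: hcoord_proj_neq0. Qed.

Lemma chart_hratio (R : realType) n r (i : 'I_r) (x : 'rV[R[i]]_(n + r.-1)) k l :
  hcoord (chart i x).2 0 k / hcoord (chart i x).2 0 l =
  affine_row i (rsubmx x) 0 k / affine_row i (rsubmx x) 0 l.
Proof. exact: hratio_proj. Qed.

Lemma chartK (R : realType) n r (i : 'I_r) (x : 'rV[R[i]]_(n + r.-1)) :
  chart_coord i (chart i x) = x.
Proof.
rewrite /chart_coord -[RHS]hsubmxK; congr row_mx; apply/rowP => k.
rewrite mxE chart_hratio affine_row_id divr1 affine_rowE.
by rewrite liftK mxE.
Qed.

Lemma holo_affine_row (R : realType) n r (i : 'I_r) k (W : set 'rV[R[i]]_(n + r.-1)) :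
  open W -> holo W (fun x => affine_row i (rsubmx x) 0 k).
Proof.
move=> oW; under eq_fun do rewrite affine_rowE.
case: unlift => [k'|]; last exact: holo_cst.
by under eq_fun do rewrite mxE; exact: holo_coord.
Qed.

Lemma holo_map_lsubmx (R : realType) n m (W : set 'rV[R[i]]_(n + m)) :
  open W -> holo_map W (@lsubmx R[i] 1 n m).
Proof. by move=> oW k; under eq_fun do rewrite mxE; exact: holo_coord. Qed.

Lemma holo_transition (R : realType) n r (i j : 'I_r) (W : set 'rV[R[i]]_(n + r.-1)) :
  open W -> (forall x, W x -> affine_row i (rsubmx x) 0 j != 0) ->
  holo_map W (fun x => chart_coord j (chart i x)).
Proof.
move=> oW nz k; rewrite /chart_coord.
under eq_fun do rewrite mxE; case: (fintype.split k) => l.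
  exact: (holo_map_lsubmx oW l).
under eq_fun do rewrite mxE chart_hratio.
apply: holoM => //; first exact: holo_affine_row.
by apply: holoV => //; exact: holo_affine_row.
Qed.

(** * Submanifolds are analytic *)

(** Near a point of its image, a local coordinate system psi of A has a
   holomorphic retraction q, and A is given there by the equations
   psi (q y) = y. *)
Lemma sub_atlas_local (R : realType) N d (A O : set 'rV[R[i]]_N)
    (D : set 'rV[R[i]]_d) psi t :
  sub_atlas A D psi -> D t -> open O -> O (psi t) ->
  exists W (q : 'rV[R[i]]_N -> 'rV[R[i]]_d),
    [/\ [/\ open W, W (psi t) & W `<=` O], holo_map W q, q (psi t) = t
      & forall y, W y -> D (q y) /\ (A y <-> psi (q y) = y)].
Proof.
move=> [oD hpsi [Q oQ im] inv] Dt oO Ot.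
have [W [q [oW Wt hq qK]]] := inv t Dt.
have qt : q (psi t) = t by exact: qK.
exists ((W `&` q @^-1` D) `&` (O `&` Q)), q; split=> //.
- split.
  + apply: openI; last exact: openI.
    by apply: open_preim => // a; exact: holo_map_cont.
  + split; first by split=> //; rewrite /= qt.
    split=> //; have : (psi @` D) (psi t) by exists t.
    by rewrite im => -[].
  + by move=> y [_ []].
- by move=> k; apply: (holo_sub _ (hq k)) => y [[]].
move=> y [[Wy Dqy] [_ Qy]]; split => //; split => [Ay|e].
  have : (psi @` D) y by rewrite im.
  by move=> [s Ds e]; rewrite -e qK// e.
have : (psi @` D) y by exists (q y).
by rewrite im => -[].
Qed.

Lemma retraction_equations (R : realType) N d (A W W' : set 'rV[R[i]]_N)
    (D : set 'rV[R[i]]_d) psi (q : 'rV[R[i]]_N -> 'rV[R[i]]_d) :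
  open D -> holo_map D psi -> open W -> holo_map W q -> W' `<=` W -> open W' ->
  (forall y, W y -> D (q y) /\ (A y <-> psi (q y) = y)) ->
  exists g : 'I_N -> 'rV[R[i]]_N -> R[i], (forall k, holo W' (g k)) /\
    forall y, W' y -> (A y <-> forall k, g k y = 0).
Proof.
move=> oD hpsi oW hq WW oW' h; exists (fun k y => psi (q y) 0 k - y 0 k); split.
  move=> k; apply: holoD => //; last by apply: holoN => //; exact: holo_coord.
  apply: (holo_comp oW' oD _ _ (hpsi k)) => [y /WW/h[]//|j].
  exact: (holo_sub WW (hq j)).
move=> y /WW/h[_ ->]; split=> [-> k|e]; first by rewrite subrr.
by apply/rowP => k; apply/eqP; rewrite -subr_eq0 e.
Qed.

(** * The blow-up in the charts of the product *)

Lemma open_chart_base (R : realType) n r (U : set 'rV[R[i]]_n) (i : 'I_r) :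
  open U -> open (chart i @^-1` [set p | U p.1]).
Proof.
move=> oU; have -> : chart i @^-1` [set p | U p.1] =
    setT `&` (@lsubmx R[i] 1 n r.-1) @^-1` U.
  by apply/seteqP; split=> x //= [].
apply: open_preim => //; first exact: openT.
by move=> a _; exact: (holo_map_cont (holo_map_lsubmx openT) I).
Qed.

Lemma open_chart_domain (R : realType) n r (i k : 'I_r) :
  open [set x : 'rV[R[i]]_(n + r.-1) | affine_row i (rsubmx x) 0 k != 0].
Proof.
rewrite -[X in open X]setTI; apply: open_neq0; first exact: openT.
by move=> a _; exact: (holo_cont (holo_affine_row i k openT) I).
Qed.

(** The equations f_k xi_l = f_l xi_k hold on the graph, hence on the blow-up; in
   the chart where xi_i = 1 they reduce to f_k = f_i xi_k. *)
Definition proportional_locus (R : realType) n r (U : set 'rV[R[i]]_n)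
    (f : 'I_r -> 'rV[R[i]]_n -> R[i]) : set ('rV[R[i]]_n * proj_space R r) :=
  [set p | U p.1 /\ forall k l, f k p.1 * hcoord p.2 0 l = f l p.1 * hcoord p.2 0 k].

Lemma proportional_locus_analytic (R : realType) n r (U : set 'rV[R[i]]_n)
    (f : 'I_r -> 'rV[R[i]]_n -> R[i]) :
  open U -> (forall j, holo U (f j)) -> analytic_subset U (proportional_locus U f).
Proof.
move=> oU hf; split=> [p []//|i]; split=> [x []//|x Ux].
have oW := open_chart_base (i := i) oU.
exists (chart i @^-1` [set p | U p.1]), r,
  (fun k x => f k (lsubmx x) - f i (lsubmx x) * affine_row i (rsubmx x) 0 k).
have hfl j : holo (chart i @^-1` [set p | U p.1]) (fun x => f j (lsubmx x)).
  exact: (holo_comp oW oU _ (holo_map_lsubmx oW) (hf j)).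
split=> //.
  move=> k; apply: holoD => //; apply: holoN => //; apply: holoM => //.
  exact: holo_affine_row.
move=> y Uy; have [c c0 e] := hcoord_proj (affine_row_neq0 i (rsubmx y)).
have eS k : hcoord (chart i y).2 0 k = c * affine_row i (rsubmx y) 0 k.
  by rewrite e [LHS]mxE.
rewrite /proportional_locus; split=> [[_ h] k|h].
  have := h k i; rewrite !eS affine_row_id mulr1.
  by rewrite (mulrC _ c) (mulrCA _ c) => /(mulfI c0) /= ->; rewrite subrr.
split=> //= k l; rewrite !eS.
have fE j : f j (lsubmx y) = f i (lsubmx y) * affine_row i (rsubmx y) 0 j.
  by apply/eqP; rewrite -subr_eq0 h.
by rewrite (fE k) (fE l); ring.
Qed.

Lemma graph_proportional (R : realType) n r (U : set 'rV[R[i]]_n)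
    (f : 'I_r -> 'rV[R[i]]_n -> R[i]) : graph U f `<=` proportional_locus U f.
Proof.
move=> [z p] [[/= Uz _] [nz /= ->]]; split => //= k l.
by have [c c0 ->] := hcoord_proj nz; rewrite !mxE; ring.
Qed.

Lemma blowup_proportional (R : realType) n r (U : set 'rV[R[i]]_n)
    (f : 'I_r -> 'rV[R[i]]_n -> R[i]) :
  open U -> (forall j, holo U (f j)) -> blowup U f `<=` proportional_locus U f.
Proof.
move=> oU hf; apply: smallest_sub; first exact: proportional_locus_analytic.
exact: graph_proportional.
Qed.

Lemma blowup_ratio (R : realType) n r (U : set 'rV[R[i]]_n)
    (f : 'I_r -> 'rV[R[i]]_n -> R[i]) p i k :
  open U -> (forall j, holo U (f j)) -> blowup U f p -> hcoord p.2 0 i != 0 ->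
  f k p.1 = hcoord p.2 0 k / hcoord p.2 0 i * f i p.1.
Proof.
move=> oU hf /(blowup_proportional oU hf)[_ h] pi0.
by apply: (mulIf pi0); rewrite h mulrAC divfK// mulrC.
Qed.

Lemma blowup_base (R : realType) n r (U : set 'rV[R[i]]_n)
    (f : 'I_r -> 'rV[R[i]]_n -> R[i]) p :
  open U -> (forall j, holo U (f j)) -> blowup U f p -> U p.1.
Proof. by move=> oU hf /(blowup_proportional oU hf)[]. Qed.

(** The blow-up is an intersection of closed sets. *)
Lemma blowup_closed (R : realType) n r (U : set 'rV[R[i]]_n)
    (f : 'I_r -> 'rV[R[i]]_n -> R[i]) (i : 'I_r) x :
  open U -> (chart i @^-1` [set p | U p.1]) x -> ~ blowup U f (chart i x) ->
  exists W, [/\ open W, W x, W `<=` chart i @^-1` [set p | U p.1] &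
    forall y, W y -> ~ blowup U f (chart i y)].
Proof.
move=> oU Ux nB.
have [A [[AU aA] gA] nA] : exists2 A, analytic_subset U A /\ graph U f `<=` A &
    ~ A (chart i x).
  by apply: contrapT => h; apply: nB => A hA; apply: contrapT => nA; apply: h; exists A.
have [_ /(_ x Ux)[W [m [g [oW Wx WU hg Ag]]]]] := aA i.
have [k gk] : exists k, g k x != 0.
  apply: contrapT => h; apply: nA; apply/(Ag x Wx) => k.
  by apply/eqP; apply: contrapT => /negP gk; apply: h; exists k.
exists (W `&` [set y | g k y != 0]); split.
- by apply: open_neq0 => // a; exact: (holo_cont (hg k)).
- by split.
- by move=> y [/WU].
- move=> y [Wy gy] By; have /(Ag y Wy)/(_ k) e : A (chart i y) by exact: By.
  by move: gy; rewrite /= e eqxx.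
Qed.

(** * The exceptional set has empty interior *)

(** A coordinate system of the blow-up lies in one chart of the product; the
   transition maps carry it to any other chart through the point. *)
Lemma blowup_coordinates (R : realType) n r (U : set 'rV[R[i]]_n)
    (f : 'I_r -> 'rV[R[i]]_n -> R[i]) (i : 'I_r) x :
  blowup_smooth U f -> blowup U f (chart i x) ->
  exists d (D : set 'rV[R[i]]_d) psi t,
    [/\ sub_atlas (chart i @^-1` blowup U f) D psi, D t & psi t = x].
Proof.
move=> sm Bx.
have [d [D [phi [[j [psi [[oD hpsi [Q oQ im] inv] ->]]]] [t Dt e]]]] := sm _ Bx.
pose D' := D `&` [set s | affine_row j (rsubmx (psi s)) 0 i != 0].
pose tau (y : 'rV[R[i]]_(n + r.-1)) := chart_coord j (chart i y).
pose V := [set y : 'rV[R[i]]_(n + r.-1) | affine_row i (rsubmx y) 0 j != 0].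
have oV : open V by exact: open_chart_domain.
have htau : holo_map V tau by exact: holo_transition.
have oD' : open D'.
  apply: (open_preim oD (open_chart_domain (n := n) (i := j) (k := i))).
  by move=> a Da; exact: (holo_map_cont hpsi).
have nzD s : D' s -> hcoord (chart j (psi s)).2 0 i != 0.
  by move=> [_ /=]; rewrite chart_hcoord_neq0.
have chV y : V y -> chart j (tau y) = chart i y.
  by move=> Vy; apply: chart_coordK; rewrite chart_hcoord_neq0.
have K s : D' s -> chart i (chart_coord i (chart j (psi s))) = chart j (psi s).
  by move=> /nzD; exact: chart_coordK.
have VD s : D' s -> V (chart_coord i (chart j (psi s))).
  move=> D's; rewrite /V /= -chart_hcoord_neq0 K// chart_hcoord_neq0.
  by rewrite affine_row_id oner_eq0.
have tauD s : D' s -> tau (chart_coord i (chart j (psi s))) = psi s.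
  by move=> D's; rewrite /tau K// chartK.
exists d, D', (fun s => chart_coord i (chart j (psi s))), t; split; last first.
- by rewrite [chart j (psi t)]e chartK.
- split=> //=; rewrite -chart_hcoord_neq0 [chart j (psi t)]e.
  by rewrite chart_hcoord_neq0 affine_row_id oner_eq0.
split=> //.
- move=> k; apply: (holo_comp oD' (open_chart_domain (n := n) (i := j) (k := i)) _ _
    (holo_transition (i := j) (j := i) _ _ k)) => //.
  + by move=> s [].
  + by move=> l; apply: (holo_sub _ (hpsi l)) => s [].
  + exact: open_chart_domain.
- exists (V `&` tau @^-1` Q).
    by apply: open_preim => // a; exact: holo_map_cont.
  apply/seteqP; split=> [_ [s D's <-]|y [By [Vy Qy]]].
    have : (psi @` D) (psi s) by exists s => //; case: D's.
    rewrite im => -[Bs Qs]; split; first by rewrite /= K.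
    by split; [exact: VD|rewrite /= tauD].
  have : (psi @` D) (tau y) by rewrite im; split=> //=; rewrite chV.
  move=> [s Ds es].
  have D's : D' s.
    split=> //=; rewrite es -chart_hcoord_neq0 chV// chart_hcoord_neq0.
    by rewrite affine_row_id oner_eq0.
  by exists s => //=; rewrite es chV// chartK.
move=> s D's; have [W [q [oW Ws hq qK]]] := inv s D's.1.
have oVW : open (V `&` tau @^-1` W) by apply: open_preim => // a; exact: holo_map_cont.
exists (V `&` tau @^-1` W), (q \o tau); split=> //.
- by split; [exact: VD|rewrite /= tauD].
- move=> k; apply: (holo_comp oVW oW _ _ (hq k)) => [y []//|l].
  by apply: (holo_sub _ (htau l)) => y [].
- move=> s' D's' [_]; rewrite /= tauD// => Ws'; apply: qK => //.
  by case: D's'.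
Qed.

(** Interior points of the exceptional set relative to the blow-up.  One chart is
   enough for the definition, since the transition maps are homeomorphisms. *)
Definition exceptional_interior (R : realType) n r (U : set 'rV[R[i]]_n)
    (f : 'I_r -> 'rV[R[i]]_n -> R[i]) : set ('rV[R[i]]_n * proj_space R r) :=
  [set p | exists (i : 'I_r) x Q, [/\ chart i x = p, open Q, Q x &
    forall y, Q y -> blowup U f (chart i y) -> exceptional U f (chart i y)]].

Lemma exceptional_interior_chart (R : realType) n r (U : set 'rV[R[i]]_n)
    (f : 'I_r -> 'rV[R[i]]_n -> R[i]) (j : 'I_r) x :
  exceptional_interior U f (chart j x) -> exists Q, [/\ open Q, Q x &
    forall y, Q y -> blowup U f (chart j y) -> exceptional U f (chart j y)].
Proof.
move=> [i [y [Q [e oO Oy OE]]]].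
pose V := [set y : 'rV[R[i]]_(n + r.-1) | affine_row j (rsubmx y) 0 i != 0].
have oV : open V by exact: open_chart_domain.
have htau : holo_map V (fun y : 'rV[R[i]]_(n + r.-1) => chart_coord i (chart j y)).
  exact: holo_transition.
have chV z : V z -> chart i (chart_coord i (chart j z)) = chart j z.
  by move=> Vz; apply: chart_coordK; rewrite chart_hcoord_neq0.
exists (V `&` (fun y : 'rV[R[i]]_(n + r.-1) => chart_coord i (chart j y)) @^-1` Q); split.
- by apply: open_preim => // a; exact: holo_map_cont.
- split; last by rewrite /= -e chartK.
  by rewrite /V /= -chart_hcoord_neq0 -e chart_hcoord_neq0 affine_row_id oner_eq0.
- by move=> z [Vz Oz]; rewrite -(chV z Vz); exact: OE.
Qed.

(** The union of the components of the blow-up on which some f_j does not vanish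
   identically is analytic: by the identity theorem, near each of its points it
   coincides with the blow-up. *)
Lemma blowup_minus_interior_analytic (R : realType) n r (U : set 'rV[R[i]]_n)
    (f : 'I_r -> 'rV[R[i]]_n -> R[i]) :
  open U -> (forall j, holo U (f j)) -> blowup_smooth U f ->
  analytic_subset U (blowup U f `\` exceptional_interior U f).
Proof.
move=> oU hf sm; split; first by move=> p [/(blowup_base oU hf)].
move=> i; have oC := open_chart_base (n := n) (i := i) oU.
split=> [x [/(blowup_base oU hf)]//|x Ux].
(* Near a point outside the set the equation 1 = 0 will do. *)
have away (W : set 'rV[R[i]]_(n + r.-1)) : open W -> W x ->
    (forall y, W y -> ~ (blowup U f `\` exceptional_interior U f) (chart i y)) ->
    exists (W : set 'rV[R[i]]_(n + r.-1)) m (g : 'I_m -> 'rV[R[i]]_(n + r.-1) -> R[i]),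
    [/\ open W, W x, W `<=` chart i @^-1` [set p | U p.1], forall k, holo W (g k)
      & forall y, W y -> ((chart i @^-1` (blowup U f `\` exceptional_interior U f)) y
          <-> forall k, g k y = 0)].
  move=> oW Wx nW; have oW' := openI oW oC.
  exists (W `&` chart i @^-1` [set p | U p.1]), 1%N, (fun _ _ => 1); split=> //.
  - by move=> k; exact: (holo_cst 1 oW').
  - move=> y [Wy _]; split=> [By|/(_ 0)/eqP]; first by case: (nW y Wy).
    by rewrite oner_eq0.
have [Bx|nBx] := pselect (blowup U f (chart i x)); last first.
  have [W [oW Wx _ WB]] := blowup_closed oU Ux nBx.
  by apply: (away W) => // y Wy [/(WB y Wy)].
have [Ix|nIx] := pselect (exceptional_interior U f (chart i x)).
  have [Q [oO Ox OE]] := exceptional_interior_chart Ix.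
  by apply: (away Q) => // y Oy [_]; apply; exists i, y, Q.
have [d [D [psi [t [hA Dt et]]]]] := blowup_coordinates sm Bx.
have [W [q [[oW Wt WC] hq qt hW]]] := sub_atlas_local hA Dt oC
  (eq_ind_r (chart i @^-1` [set p | U p.1]) Ux et).
have [oD hpsi _ _] := hA.
have [N [tN ND ident]] := local_identity oD Dt.
pose W' := W `&` q @^-1` N°.
have oW' : open W'.
  apply: open_preim => //; first exact: open_interior.
  by move=> a; exact: holo_map_cont.
have W't : W' (psi t).
  have Nt : N° (q (psi t)) by rewrite qt; exact: tN.
  exact: (conj Wt Nt).
have [g [hg Wg]] := retraction_equations oD hpsi oW hq (fun y (h : W' y) => h.1) oW' hW.
exists W', (n + r.-1)%N, g.
split; [exact: oW'|by rewrite -et|by move=> y [/WC]|exact: hg|].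
have UD s : D s -> (chart i @^-1` blowup U f) (psi s).
  move=> Ds; have [_ _ [Q _ im] _] := hA.
  have : (psi @` D) (psi s) by exists s.
  by rewrite im => -[].
have hfpsi j : holo D (fun s => f j (lsubmx (psi s))).
  have hlp : holo_map D (fun s => lsubmx (psi s)).
    move=> k; apply: (holo_comp oD oC _ hpsi (holo_map_lsubmx oC k)) => s.
    by move=> /UD/(blowup_base oU hf).
  by apply: (holo_comp oD oU _ hlp (hf j)) => s /UD/(blowup_base oU hf).
move=> y W'y; rewrite -Wg//; split=> [[]//|By]; split=> // Iy.
have [Wy /interior_subset Nqy] := W'y.
have ey : psi (q y) = y by apply/(hW y Wy).2.
have [Q [oO Oy OE]] := exceptional_interior_chart Iy.
have vanish j c : N c -> f j (lsubmx (psi c)) = 0.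
  apply: (ident _ (hfpsi j) _ Nqy).
  have : open (D `&` psi @^-1` Q) by apply: open_preim => // a; exact: holo_map_cont.
  move=> oDO; have : nbhs (q y) (D `&` psi @^-1` Q).
    by apply: open_nbhs_nbhs; split=> //; split; [exact: (hW y Wy).1|rewrite /= ey].
  apply: filterS => s [Ds Os].
  by have [_] := OE _ Os (UD s Ds); exact.
apply: nIx; exists i, x, W'; split; [exact: erefl|exact: oW'|by rewrite -et|].
move=> z [Wz /interior_subset Nqz] Bz; split => // j.
have ez : psi (q z) = z by apply/(hW z Wz).2.
by rewrite /= -ez; exact: vanish.
Qed.

(** The blow-up minus these points is a closed analytic set that contains the
   graph, so it is the whole blow-up by minimality. *)
Lemma exceptional_interior0 (R : realType) n r (U : set 'rV[R[i]]_n)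
    (f : 'I_r -> 'rV[R[i]]_n -> R[i]) p :
  open U -> (forall j, holo U (f j)) -> blowup_smooth U f ->
  blowup U f p -> ~ exceptional_interior U f p.
Proof.
move=> oU hf sm Bp.
have : blowup U f `<=` blowup U f `\` exceptional_interior U f.
  apply: smallest_sub; first exact: blowup_minus_interior_analytic.
  move=> z Gz; have Bz : blowup U f z by apply: sub_gen_smallest Gz.
  split=> // -[i [x [Q [e oO Ox OE]]]].
  have [_ fz] := OE x Ox (eq_ind_r (blowup U f) Bz e).
  have [_ [nz _]] := Gz; move/eqP: nz; apply.
  by apply/rowP => j; rewrite !mxE -e fz.
by move=> /(_ p Bp)[].
Qed.

(** A section f_i that vanishes on W forces all f_k to vanish there, so W would
   consist of interior points of the exceptional set. *)
Lemma exceptional_nowhere_dense (R : realType) n r (U : set 'rV[R[i]]_n)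
    (f : 'I_r -> 'rV[R[i]]_n -> R[i]) (i : 'I_r) W :
  open U -> (forall j, holo U (f j)) -> blowup_smooth U f ->
  mopen (blowup_atlas U f) W -> W `<=` lb_dom (exceptional_bundle U f) i ->
  W !=set0 -> exists2 p, W p & f i p.1 != 0.
Proof.
move=> oU hf sm [_ Wopen] WV [p Wp]; apply: contrapT => h.
have WE z : W z -> exceptional U f z.
  move=> Wz; have [Bz zi] := WV z Wz; split => // j.
  rewrite (blowup_ratio (i := i) j oU hf Bz zi).
  have -> : f i z.1 = 0 by apply/eqP; apply: contrapT => /negP fz; apply: h; exists z.
  by rewrite mulr0.
have [Bp pi0] := WV p Wp; apply: (exceptional_interior0 oU hf sm Bp).
have ep := chart_coordK pi0.
have Bx : blowup U f (chart i (chart_coord i p)) by rewrite ep.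
have [d [D [psi [t [hA Dt et]]]]] := blowup_coordinates sm Bx.
have [Q [q [[oO Ot _] hq qt hO]]] := sub_atlas_local hA Dt (@openT _) I.
have oDW : open (D `&` (chart i \o psi) @^-1` W) by apply: Wopen; exists i, psi.
exists i, (psi t), (Q `&` q @^-1` (D `&` (chart i \o psi) @^-1` W)); split.
- by rewrite et.
- by apply: open_preim => // a; exact: holo_map_cont.
- by split=> //=; rewrite qt; split=> //; rewrite et ep.
- move=> y [Oy [_ /= Wy]] By; apply: WE.
  by have <- : psi (q y) = y by apply/(hO y Oy).2.
Qed.

(** * The line bundle and its metric *)

Lemma blowup_atlas_holo (R : realType) n r (U : set 'rV[R[i]]_n)
    (f : 'I_r -> 'rV[R[i]]_n -> R[i]) d (D : set 'rV[R[i]]_d) phi :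
  open U -> (forall j, holo U (f j)) -> blowup_atlas U f D phi ->
  [/\ open D, forall s, D s -> blowup U f (phi s), holo_map D (fst \o phi),
      forall i, open (D `&` phi @^-1` lb_dom (exceptional_bundle U f) i)
    & forall i k, holo (D `&` phi @^-1` lb_dom (exceptional_bundle U f) i)
        (fun s => hcoord (phi s).2 0 k / hcoord (phi s).2 0 i)].
Proof.
move=> oU hf [j [psi [[oD hpsi [Q _ im] _] ->]]].
have BD s : D s -> blowup U f (chart j (psi s)).
  move=> Ds; have : (psi @` D) (psi s) by exists s.
  by rewrite im => -[].
have hcomp g : holo setT g -> holo D (fun s => g (psi s)).
  by move=> hg; exact: (holo_comp oD openT (fun _ _ => I) hpsi hg).
have domE i : D `&` (chart j \o psi) @^-1` lb_dom (exceptional_bundle U f) i =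
    D `&` [set s | affine_row j (rsubmx (psi s)) 0 i != 0].
  apply/seteqP; split=> s [Ds].
    by move=> [_]; rewrite /= chart_hcoord_neq0.
  by move=> ne; split=> //; split; [exact: BD|rewrite /= chart_hcoord_neq0].
have haff k := hcomp _ (holo_affine_row j k openT).
have odom i : open (D `&` (chart j \o psi) @^-1` lb_dom (exceptional_bundle U f) i).
  by rewrite domE; apply: open_neq0 => // a; exact: (holo_cont (haff i)).
split=> //; first by move=> k; exact: (hcomp _ (holo_map_lsubmx openT k)).
move=> i k; have oW := odom i; rewrite domE in oW *.
apply: (holo_ext oW (g := fun s => affine_row j (rsubmx (psi s)) 0 k /
    affine_row j (rsubmx (psi s)) 0 i)) => [s _|]; first by rewrite /= chart_hratio.
apply: holoM => //; first by apply: (holo_sub _ (haff k)) => s [].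
apply: holoV => //; first by move=> s [].
by apply: (holo_sub _ (haff i)) => s [].
Qed.

Lemma bundle_dom_open (R : realType) n r (U : set 'rV[R[i]]_n)
    (f : 'I_r -> 'rV[R[i]]_n -> R[i]) i :
  open U -> (forall j, holo U (f j)) -> blowup_smooth U f ->
  mopen (blowup_atlas U f) (lb_dom (exceptional_bundle U f) i).
Proof.
move=> oU hf sm; split=> [p [Bp _]|d D phi Mphi]; first exact: sm.
by have [_ _ _ + _] := blowup_atlas_holo oU hf Mphi; exact.
Qed.

Lemma exceptional_line_bundle (R : realType) n r (U : set 'rV[R[i]]_n)
    (f : 'I_r -> 'rV[R[i]]_n -> R[i]) :
  open U -> (forall j, holo U (f j)) -> blowup_smooth U f ->
  is_line_bundle (blowup_atlas U f) (exceptional_bundle U f).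
Proof.
move=> oU hf sm; split.
- by move=> i; exact: bundle_dom_open.
- move=> p [d [D [phi [Mphi [t Dt <-]]]]].
  have [_ BD _ _ _] := blowup_atlas_holo oU hf Mphi.
  by have [i pi0] := hcoord_ex (phi t).2; exists i; split => //; exact: BD.
- move=> i j d D phi Mphi; have [_ _ _ _ h] := blowup_atlas_holo oU hf Mphi.
  by apply: (holo_sub _ (h j i)) => s [Ds []].
- by move=> i j p [_ /= pi0] [_ /= pj0]; rewrite mulf_neq0// invr_eq0.
- move=> i j k p [_ /= pi0] [_ /= pj0] [_ /= pk0].
  by rewrite mulrA divfK.
Qed.

Lemma exceptional_divisor_bundle (R : realType) n r (U : set 'rV[R[i]]_n)
    (f : 'I_r -> 'rV[R[i]]_n -> R[i]) :
  open U -> (forall j, holo U (f j)) -> blowup_smooth U f ->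
  is_divisor_bundle (blowup_atlas U f) (fun j p => f j p.1)
    (exceptional_bundle U f) (fun i p => f i p.1).
Proof.
move=> oU hf sm.
have hF j d (D : set 'rV[R[i]]_d) phi : blowup_atlas U f D phi ->
    holo D (fun s => f j (phi s).1).
  move=> Mphi; have [oD BD h1 _ _] := blowup_atlas_holo oU hf Mphi.
  by apply: (holo_comp oD oU _ h1 (hf j)) => s /BD/(blowup_base oU hf).
split.
- exact: exceptional_line_bundle.
- by move=> i d D phi Mphi; apply: (holo_sub _ (hF i d D phi Mphi)) => s [].
- move=> i p Vp; exists (lb_dom (exceptional_bundle U f) i); split=> //.
  + exact: bundle_dom_open.
  + move=> _; exists (fun k _ => (k == i)%:R).
      move=> k d D phi Mphi; apply: holo_cst.
      by have [_ _ _ + _] := blowup_atlas_holo oU hf Mphi; exact.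
    move=> q _; rewrite (bigD1 i)//= eqxx mul1r big1 ?addr0// => k ki.
    by rewrite (negbTE ki) mul0r.
  + move=> k; exists (fun _ q => hcoord q.2 0 k / hcoord q.2 0 i).
      move=> _ d D phi Mphi; have [_ _ _ _ h] := blowup_atlas_holo oU hf Mphi.
      exact: h.
    move=> q [Bq qi]; rewrite big_ord_recl big_ord0 addr0.
    exact: (blowup_ratio k oU hf Bq qi).
- by move=> i W; exact: exceptional_nowhere_dense.
- by move=> i j p [Bp _] [_ pj]; exact: (blowup_ratio i oU hf Bp pj).
Qed.

Lemma taut_metricE (R : realType) r (i : 'I_r) (p : proj_space R r) :
  hcoord p 0 i != 0 ->
  taut_metric i p = \sum_j sqnorm (hcoord p 0 j / hcoord p 0 i).
Proof. by move=> pi0; rewrite (bigD1 i)//= divff// sqnorm1. Qed.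

Lemma induced_hermitian_metric (R : realType) n r (U : set 'rV[R[i]]_n)
    (f : 'I_r -> 'rV[R[i]]_n -> R[i]) :
  open U -> (forall j, holo U (f j)) ->
  is_hermitian_metric (blowup_atlas U f) (exceptional_bundle U f)
    (@induced_metric R n r).
Proof.
move=> oU hf; split.
- move=> i d D phi Mphi k; have [_ _ _ oW h] := blowup_atlas_holo oU hf Mphi.
  apply: (Ck_ext (oW i) (g := fun s => 1 + \sum_(j | j != i)
    (hcoord (phi s).2 0 j / hcoord (phi s).2 0 i) *
    conjc (hcoord (phi s).2 0 j / hcoord (phi s).2 0 i))).
    move=> s _; rewrite /induced_metric /taut_metric /= rmorphD rmorph1; congr (_ + _).
    exact: (esym (sum_sqnormC _ _ _)).
  apply: CkD; [exact: oW|exact: Ck_cst|apply: Ck_sum; first exact: oW].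
  move=> j _; apply: CkM; [exact: oW|exact: ((h i j).1 k)|].
  by apply: Ck_conj; [exact: oW|exact: ((h i j).1 k)].
- by move=> i p _; rewrite ltr_pwDl// sumr_ge0// => j _; exact: sqnorm_ge0.
- move=> i j p [_ /= pi0] [_ /= pj0]; rewrite /induced_metric !taut_metricE//.
  rewrite mulr_sumr; apply: eq_bigr => k _; rewrite -sqnormM; congr sqnorm.
  by rewrite [RHS]mulrC mulrA divfK.
Qed.

(** * The Chern form *)

Lemma rderive_ext (R : realType) m (W : set 'rV[R[i]]_m)
    (g g' : 'rV[R[i]]_m -> R[i]) v a :
  open W -> W a -> (forall b, W b -> g b = g' b) -> rderive g v a = rderive g' v a.
Proof.
move=> oW Wa e; have nr := open_line v oW Wa.
by rewrite /rderive !derive1E; congr Complex; apply: near_eq_derive;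
  apply: filterS nr => x /e ->.
Qed.

Lemma dz_ext (R : realType) m (W : set 'rV[R[i]]_m)
    (g g' : 'rV[R[i]]_m -> R[i]) j a :
  open W -> W a -> (forall b, W b -> g b = g' b) ->
  dz j g a = dz j g' a /\ dzbar j g a = dzbar j g' a.
Proof. by move=> oW Wa e; rewrite /dz /dzbar !(rderive_ext _ oW Wa e). Qed.

Lemma ddbar_ext (R : realType) m (W : set 'rV[R[i]]_m) (u u' : 'rV[R[i]]_m -> R) a :
  open W -> W a -> (forall b, W b -> u b = u' b) -> ddbar u a = ddbar u' a.
Proof.
move=> oW Wa e; apply/matrixP => j k; rewrite [LHS]mxE [RHS]mxE.
have eC b : W b -> (u b)%:C%C = (u' b)%:C%C by move=> /e ->.
have e2 b : W b -> dzbar k (fun b => (u b)%:C%C) b = dzbar k (fun b => (u' b)%:C%C) b.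
  by move=> Wb; exact: (dz_ext k oW Wb eC).2.
exact: (dz_ext j oW Wa e2).1.
Qed.

(** On {xi_i != 0} the weight of the metric is the sum of the |xi_l / xi_i|^2. *)
Lemma chern_form_minors (R : realType) n r (U : set 'rV[R[i]]_n)
    (f : 'I_r -> 'rV[R[i]]_n -> R[i]) d (D : set 'rV[R[i]]_d) phi i t :
  open U -> (forall j, holo U (f j)) -> blowup_atlas U f D phi -> D t ->
  lb_dom (exceptional_bundle U f) i (phi t) ->
  let w l s := hcoord (phi s).2 0 l / hcoord (phi s).2 0 i in
  chern_form (@induced_metric R n r i) phi t =
  (- ('i%C / (2 * pi)%:C%C)) *: minors_form (w^~ t) (fun j l => dz j (w l) t).
Proof.
move=> oU hf Mphi Dt Vt w.
have [oD BD hphi oW hw] := blowup_atlas_holo oU hf Mphi.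
have Wt : (D `&` phi @^-1` lb_dom (exceptional_bundle U f) i) t by exact: (conj Dt Vt).
rewrite /chern_form /curvature; congr (_ *: _).
rewrite (ddbar_ext (u' := fun s => ln (\sum_l sqnorm (w l s))) (oW i) Wt).
  apply: (ddbar_ln_sum (oW i) Wt (hw i)) => s [_ [_ /= si]].
  by rewrite -taut_metricE// ltr_pwDl// sumr_ge0// => j _; exact: sqnorm_ge0.
by move=> s [_ [_ /= si]]; rewrite /induced_metric taut_metricE.
Qed.

Lemma herm_minors_le0 (R : realType) m N (w : 'I_N -> R[i])
    (dw : 'I_m -> 'I_N -> R[i]) (v : 'rV[R[i]]_m) :
  herm_of_form ((- ('i%C / (2 * pi)%:C%C)) *: minors_form w dw) v <= 0.
Proof.
rewrite herm_minors_form lecR oppr_le0 divr_ge0//.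
  by apply: sumr_ge0 => l _; apply: sumr_ge0 => p _; exact: sqnorm_ge0.
by rewrite mulr_ge0 ?sqr_ge0// mulr_ge0 ?pi_ge0.
Qed.

(** If w_i = 1 is constant, the minors that involve w_i are the components of
   dw(v). *)
Lemma herm_minors_lt0 (R : realType) m N (w : 'I_N -> R[i])
    (dw : 'I_m -> 'I_N -> R[i]) (v : 'rV[R[i]]_m) i l :
  w i = 1 -> (forall j, dw j i = 0) -> \sum_j v 0 j * dw j l != 0 ->
  herm_of_form ((- ('i%C / (2 * pi)%:C%C)) *: minors_form w dw) v < 0.
Proof.
move=> wi dwi Al; rewrite herm_minors_form ltcR oppr_lt0.
have sq := @sqnorm_ge0 R.
have S0 : 0 < \sum_l sqnorm (w l).
  by rewrite (bigD1 i)//= wi sqnorm1 ltr_pwDl// sumr_ge0.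
apply: divr_gt0; last by rewrite mulr_gt0 ?exprn_gt0// mulr_gt0 ?pi_gt0.
rewrite (bigD1 l)//= ltr_pwDl//; last first.
  by apply: sumr_ge0 => k _; apply: sumr_ge0.
rewrite (bigD1 i)//= ltr_pwDl//; last exact: sumr_ge0.
have -> : \sum_j v 0 j * dw j i = 0 by apply: big1 => j _; rewrite dwi mulr0.
by rewrite wi mulr1 mul0r subr0 lt_neqAle eq_sym sqnorm_eq0 Al sq.
Qed.

Lemma holo_cder (R : realType) m (W : set 'rV[R[i]]_m) g (v a : 'rV[R[i]]_m) :
  open W -> holo W g -> W a ->
  cder (fun x : R => g (a + x%:C%C *: v)) 0 (\sum_k v 0 k * dz k g a).
Proof.
move=> oW hg Wa; apply: (cder_eqval (holo_wdiff oW hg Wa v)).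
by apply: eq_bigr => k _; rewrite mulr0 addr0.
Qed.

(** A coordinate system of a submanifold is an immersion, since it has a
   holomorphic left inverse. *)
Lemma sub_atlas_immersion (R : realType) N d (A : set 'rV[R[i]]_N)
    (D : set 'rV[R[i]]_d) psi t (v : 'rV[R[i]]_d) :
  sub_atlas A D psi -> D t ->
  (forall j, \sum_k v 0 k * dz k (fun s => psi s 0 j) t = 0) -> v = 0.
Proof.
move=> [oD hpsi _ inv] Dt h; have [W [q [oW Wt hq qK]]] := inv t Dt.
have oD' : open (D `&` psi @^-1` W) by apply: open_preim => // a; exact: holo_map_cont.
have D't : (D `&` psi @^-1` W) t by exact: (conj Dt Wt).
have hpsi' : holo_map (D `&` psi @^-1` W) psi.
  by move=> k; apply: (holo_sub _ (hpsi k)) => s [].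
apply/rowP => k; rewrite mxE.
have c1 := wdiff_comp oD' oW D't Wt hpsi' (hq k) v.
have c2 : cder (fun x : R => (t + x%:C%C *: v) 0 k) 0 (v 0 k).
  under eq_fun do rewrite !mxE.
  exact: (cder_eqval (cderD (cder_cst _ _) (cder_id _ _)) (add0r _)).
have e s : (D `&` psi @^-1` W) s -> q (psi s) 0 k = s 0 k.
  by move=> [Ds Ws]; rewrite qK.
have := cder_uniq c2 (cder_line_ext oD' D't e c1).
move=> ->; under eq_bigr do rewrite mulr0 addr0 mulr_sumr.
rewrite exchange_big big1// => j _.
by under eq_bigr do rewrite mulrA; rewrite -mulr_suml h mul0r.
Qed.

(** A tangent vector of the blow-up that is killed by the differentials of z and
   of all ratios xi_l / xi_i is zero. *)
Lemma blowup_tangent_eq0 (R : realType) n r (U : set 'rV[R[i]]_n)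
    (f : 'I_r -> 'rV[R[i]]_n -> R[i]) d (D : set 'rV[R[i]]_d) phi i t
    (v : 'rV[R[i]]_d) :
  open U -> (forall j, holo U (f j)) -> blowup_atlas U f D phi -> D t ->
  lb_dom (exceptional_bundle U f) i (phi t) -> fibre_tangent phi t v ->
  (forall l, \sum_k v 0 k *
     dz k (fun s => hcoord (phi s).2 0 l / hcoord (phi s).2 0 i) t = 0) ->
  v = 0.
Proof.
move=> oU hf Mphi Dt Vt fib dw0.
have [oD BD hphi oW hw] := blowup_atlas_holo oU hf Mphi.
have [j [psi [hA ephi]]] := Mphi.
have Wt : (D `&` phi @^-1` lb_dom (exceptional_bundle U f) i) t by exact: (conj Dt Vt).
pose w l s := hcoord (phi s).2 0 l / hcoord (phi s).2 0 i.
apply: (sub_atlas_immersion hA Dt) => k.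
rewrite -[k]splitK; case: (fintype.split k) => l /=.
  have -> : (fun s => psi s 0 (lshift r.-1 l)) = fun s => (fst \o phi) s 0 l.
    by apply/funext => s; rewrite ephi /= mxE.
  have /rowP/(_ l) fl := fib; rewrite [LHS]mxE [RHS]mxE in fl.
  by rewrite -[RHS]fl; apply: eq_bigr => k' _; rewrite [X in _ = _ * X]mxE.
have wj0 : w j t != 0.
  rewrite mulf_neq0// ?invr_eq0 ?Vt.2// ephi /= chart_hcoord_neq0.
  by rewrite affine_row_id oner_eq0.
have hpsi : holo D (fun s => psi s 0 (rshift n l)) by have [_ h _ _] := hA.
have c1 := holo_cder v oD hpsi Dt.
have cw l' : cder (fun x : R => w l' (t + x%:C%C *: v)) 0 0.
  by have := holo_cder v (oW i) (hw i l') Wt; rewrite dw0.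
have wj0' : w j (t + (0 : R)%:C%C *: v) != 0 by rewrite line0.
have c2 := cderM (cw (lift j l)) (cderV wj0' (cw j)).
have e s : (D `&` phi @^-1` lb_dom (exceptional_bundle U f) i) s ->
    w (lift j l) s * (w j s)^-1 = psi s 0 (rshift n l).
  move=> [_ [_ /= si]]; rewrite /w invfM invrK mulrACA mulVf// mulr1.
  by rewrite ephi /= chart_hratio affine_row_id divr1 affine_rowE liftK mxE.
rewrite (cder_uniq c1 (cder_line_ext (oW i) Wt e c2)).
by rewrite mul0r oppr0 mul0r mulr0 addr0.
Qed.

(** Off the exceptional set xi_l / xi_i = f_l / f_i, and the common factor 1 / f_i
   does not change the minors. *)
Lemma chern_form_off_exceptional (R : realType) n r (U : set 'rV[R[i]]_n)
    (f : 'I_r -> 'rV[R[i]]_n -> R[i]) d (D : set 'rV[R[i]]_d) phi i t :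
  open U -> (forall j, holo U (f j)) -> blowup_atlas U f D phi -> D t ->
  lb_dom (exceptional_bundle U f) i (phi t) -> ~ exceptional U f (phi t) ->
  chern_form (@induced_metric R n r i) phi t =
  pullback_form (fst \o phi)
    (curvature (fun z => ln (\sum_j sqnorm (f j z)))) t.
Proof.
move=> oU hf Mphi Dt Vt nE.
have [oD BD hphi oW hw] := blowup_atlas_holo oU hf Mphi.
have UD s : D s -> U ((fst \o phi) s) by move=> /BD/(blowup_base oU hf).
pose g l s := f l (phi s).1.
have hg l : holo D (g l) by exact: (holo_comp oD oU UD hphi (hf l)).
have git : g i t != 0.
  apply: contra_notN nE => /eqP gi; split=> [|k]; first exact: BD.
  by rewrite (blowup_ratio (i := i) k oU hf (BD t Dt) Vt.2) -/(g i t) gi mulr0.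
rewrite (chern_form_minors oU hf Mphi Dt Vt) /pullback_form /curvature.
rewrite -scalemxAr -scalemxAl; congr (_ *: _).
set F := fst \o phi; pose UF := U `&` [set z | f i z != 0].
have oUF : open UF by apply: open_neq0 => // a; exact: (holo_cont (hf i)).
have UFt : UF (F t) by split; [exact: UD|].
rewrite (ddbar_ln_sum oUF UFt); first last.
- move=> z [_ /= fz]; rewrite (bigD1 i)//= ltr_pwDl ?sumr_ge0//.
    by rewrite lt_neqAle eq_sym sqnorm_eq0 fz sqnorm_ge0.
  by move=> j _; exact: sqnorm_ge0.
- by move=> l; apply: (holo_sub _ (hf l)) => z [].
rewrite minors_form_pullback.
have dg l j : \sum_k Defs.jacobian F t j k * dz k (f l) (F t) = dz j (g l) t.
  have [-> _] := wdiff_dz j (wdiff_comp oD oU Dt (UD t Dt) hphi (hf l)).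
  by apply: eq_bigr => k _; rewrite mxE.
pose W := D `&` [set s | g i s != 0].
have oWg : open W by apply: open_neq0 => // a; exact: (holo_cont (hg i)).
have Wt : W t by exact: (conj Dt git).
have hgW l : holo W (g l) by apply: (holo_sub _ (hg l)) => s [].
have hc : holo W (fun s => (g i s)^-1) by apply: holoV => // s [].
pose w l s := hcoord (phi s).2 0 l / hcoord (phi s).2 0 i.
pose W2 := W `&` (D `&` phi @^-1` lb_dom (exceptional_bundle U f) i).
have oW2 : open W2 by apply: openI => //; exact: oW.
have W2t : W2 t by exact: (conj Wt (conj Dt Vt)).
have e l s : W2 s -> (g i s)^-1 * g l s = w l s.
  move=> [[_ /= gis] [Ds [Bs /= si]]].
  by rewrite [g l s](blowup_ratio l oU hf Bs si) mulrC mulfK.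
have dw l j : dz j (w l) t =
    dz j (fun s => (g i s)^-1) t * g l t + (g i t)^-1 * dz j (g l) t.
  have := wdiff_ext oW2 W2t (e l)
    (wdiffM (holo_wdiff oWg hc Wt) (holo_wdiff oWg (hgW l) Wt)).
  by move=> /(wdiff_dz j)[].
have giV : (g i t)^-1 != 0 by rewrite invr_eq0.
rewrite -[RHS](minors_form_scale _ _ (fun j => dz j (fun s => (g i s)^-1) t) giV).
congr minors_form; first by apply/funext => l; exact: (esym (e l t W2t)).
by apply/funext => j; apply/funext => l; rewrite dg; exact: dw.
Qed.

Theorem mainTheorem6 (R : realType) (n r : nat) (U : set 'rV[R[i]]_n)
    (f : 'I_r -> 'rV[R[i]]_n -> R[i]) :
  open U ->
  (forall j, holo U (f j)) ->
  codim_ge1 (zero_locus U f) ->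
  ~ principal_ideal U f ->
  blowup_smooth U f ->
  let M := blowup_atlas U f in
  let E := exceptional U f in
  let L := exceptional_bundle U f in
  let h := @induced_metric R n r in
  [/\ is_divisor_bundle M (fun j p => f j p.1) L (fun i p => f i p.1),
      is_hermitian_metric M L h,
      forall d (D : set 'rV[R[i]]_d) phi i t,
        M d D phi -> D t -> lb_dom L i (phi t) ->
        forall v : 'rV[R[i]]_d, herm_of_form (chern_form (h i) phi t) v <= 0,
      forall d (D : set 'rV[R[i]]_d) phi i t,
        M d D phi -> D t -> lb_dom L i (phi t) -> E (phi t) ->
        forall v : 'rV[R[i]]_d, v != 0 -> fibre_tangent phi t v ->
          herm_of_form (chern_form (h i) phi t) v < 0
    & forall d (D : set 'rV[R[i]]_d) phi i t,
        M d D phi -> D t -> lb_dom L i (phi t) -> ~ E (phi t) ->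
        chern_form (h i) phi t =
        pullback_form (fst \o phi)
          (curvature (fun z => ln (\sum_j sqnorm (f j z)))) t].
Proof.
move=> oU hf _ _ sm M E L h; split.
- exact: exceptional_divisor_bundle.
- exact: induced_hermitian_metric.
- move=> d D phi i t Mphi Dt Vt v.
  by rewrite (chern_form_minors oU hf Mphi Dt Vt); exact: herm_minors_le0.
- move=> d D phi i t Mphi Dt Vt _ v v0 fib.
  rewrite (chern_form_minors oU hf Mphi Dt Vt).
  have [oD BD hphi oW hw] := blowup_atlas_holo oU hf Mphi.
  have Wt : (D `&` phi @^-1` lb_dom L i) t by exact: (conj Dt Vt).
  pose w l s := hcoord (phi s).2 0 l / hcoord (phi s).2 0 i.
  have [l Al] : exists l, \sum_k v 0 k * dz k (w l) t != 0.
    apply: contrapT => nl; move/eqP: v0; apply.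
    apply: (blowup_tangent_eq0 oU hf Mphi Dt Vt fib) => l.
    by apply/eqP; apply: contrapT => /negP Al; apply: nl; exists l.
  apply: (herm_minors_lt0 (i := i) _ _ Al); first by rewrite divff// Vt.2.
  move=> j; have e s : (D `&` phi @^-1` lb_dom L i) s -> 1 = w i s.
    by move=> [_ [_ /= si]]; rewrite /w divff.
  by have [] := wdiff_dz j (wdiff_ext (oW i) Wt e (wdiff_cst 1 t)).
- move=> d D phi i t Mphi Dt Vt nE.
  exact: (chern_form_off_exceptional oU hf Mphi Dt Vt nE).
Qed.
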